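(* Let $\mathfrak g$ be a definable hereditarily $\widetilde{\mathfrak M}_c$-Lie ring and $\mathfrak h$ a Lie subring of $\mathfrak g$ (not necessarily definable). Then: \begin{itemize} \item if $\mathfrak h$ is soluble, it is contained in a definable soluble Lie subring $\mathfrak h_1$ of $\mathfrak g$ such that $N_{\mathfrak g}(\mathfrak h)\le N_{\mathfrak g}(\mathfrak h_1)$; \item if $\mathfrak h$ is nilpotent, it is contained in a definable nilpotent Lie subring $\mathfrak h_1$ of $\mathfrak g$ such that $N_{\mathfrak g}(\mathfrak h)\le N_{\mathfrak g}(\mathfrak h_1)$. \end{itemize}
   Context: A Lie ring is an abelian group $(\mathfrak g,+)$ with a biadditive antisymmetric bracket satisfying the Jacobi identity. $\mathfrak g$ is definable in some first-order structure. For a subgroup $N\le(\mathfrak g,+)$ and $g_1,\dots,g_i\in\mathfrak g$ let $C_{\mathfrak g}(g_1,\dots,g_i/N)=\{x\in\mathfrak g:[x,g_j]\in N\text{ for all }j\le i\}$. A definable Lie ring $\mathfrak g$ is hereditarily $\widetilde{\mathfrak M}_c$ if for every definable subgroup $N$ of $\mathfrak g$ there exist $n,d<\omega$ such that there are no $g_1,\dots,g_n\in\mathfrak g$ with $|C_{\mathfrak g}(g_1,\dots,g_i/N):C_{\mathfrak g}(g_1,\dots,g_{i+1}/N)|\ge d$ for every $i\le n-1$. The normaliser of a Lie subring $\mathfrak h$ is $N_{\mathfrak g}(\mathfrak h)=\{x\in\mathfrak g:[x,\mathfrak h]\subseteq\mathfrak h\}$. *)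

(* Defs.v *)
From HB Require Import structures.
From mathcomp Require Import all_boot all_algebra.
From mathcomp Require Import boolp classical_sets functions cardinality.

Set Implicit Arguments.
Unset Strict Implicit.
Unset Printing Implicit Defensive.

Import GRing.Theory.
Local Open Scope classical_set_scope.
Local Open Scope card_scope.
Local Open Scope ring_scope.

(** * First-order structures and definable sets *)

Record language := Language {
  fsym : Type;
  farity : fsym -> nat;
  rsym : Type;
  rarity : rsym -> nat }.

Record fo_structure (L : language) := FOStructure {
  dom :> Type;
  finterp : forall f : fsym L, ('I_(farity f) -> dom) -> dom;
  rinterp : forall r : rsym L, ('I_(rarity r) -> dom) -> Prop }.

Inductive term (L : language) : Type :=
| Var of nat
| App (f : fsym L) of ('I_(farity f) -> term L).

Inductive formula (L : language) : Type :=
| Bot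
| Equal of term L & term L
| Rel (r : rsym L) of ('I_(rarity r) -> term L)
| Imp of formula L & formula L
| Forall of nat & formula L.

Fixpoint teval (L : language) (M : fo_structure L) (v : nat -> M)
    (t : term L) : M :=
  match t with
  | Var i => v i
  | App f args => finterp (fun j => teval v (args j))
  end.

Fixpoint sat (L : language) (M : fo_structure L) (v : nat -> M)
    (phi : formula L) : Prop :=
  match phi with
  | Bot => False
  | Equal t u => teval v t = teval v u
  | Rel r args => rinterp (fun j => teval v (args j))
  | Imp phi1 phi2 => sat v phi1 -> sat v phi2
  | Forall i phi1 => forall a : M, sat (fun j => if j == i then a else v j) phi1
  end.

(** Definability is with parameters: the variables [0, ..., k - 1] stand for the
    coordinates of the point [x], and the variables [i >= k] that occur freely
    in [phi] (finitely many of them) take the parameters [v i]. *)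
Definition definable (L : language) (M : fo_structure L) (k : nat)
    (X : set (k.-tuple M)) : Prop :=
  exists (phi : formula L) (v : nat -> M),
    X = [set x : k.-tuple M | sat (fun i => nth (v i) x i) phi].

(** * Lie rings *)

HB.mixin Record isLieRing V of GRing.Zmodule V := {
  bracket : V -> V -> V;
  bracketDl : left_distributive bracket +%R;
  bracketDr : right_distributive bracket +%R;
  bracket_antisym : forall x y : V, bracket x y = - bracket y x;
  bracket_jacobi : forall x y z : V,
    bracket x (bracket y z) + bracket y (bracket z x)
      + bracket z (bracket x y) = 0 }.

#[short(type="lieRingType")]
HB.structure Definition LieRing := {V of GRing.Zmodule V & isLieRing V}.

(** A Lie ring is definable in [M] when it is identified, by [coords], with a
    definable subset of a cartesian power of [M] in such a way that the graphs
    of the addition and of the bracket are definable. *)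
Record definable_lie_ring (L : language) (M : fo_structure L)
    (g : lieRingType) := DefinableLieRing {
  arity : nat;
  coords : g -> arity.-tuple M;
  coords_inj : injective coords;
  definable_carrier : definable (range coords);
  definable_add : definable
    (range (fun p : g * g =>
       [tuple of coords p.1 ++ coords p.2 ++ coords (p.1 + p.2)]));
  definable_bracket : definable
    (range (fun p : g * g =>
       [tuple of coords p.1 ++ coords p.2 ++ coords (bracket p.1 p.2)])) }.

Definition definable_subset (L : language) (M : fo_structure L)
    (g : lieRingType) (D : definable_lie_ring M g) (X : set g) : Prop :=
  definable (coords D @` X).

Definition subgroup (V : zmodType) (N : set V) : Prop :=
  N 0 /\ forall x y : V, N x -> N y -> N (x - y).

Definition lie_subring (g : lieRingType) (h : set g) : Prop :=
  subgroup h /\ forall x y : g, h x -> h y -> h (bracket x y).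

Definition bracket_subgroup (g : lieRingType) (A B : set g) : set g :=
  smallest (@subgroup g) [set bracket a b | a in A & b in B].

Definition derived_series (g : lieRingType) (h : set g) (n : nat) : set g :=
  iter n (fun A => bracket_subgroup A A) h.

Definition lower_central_series (g : lieRingType) (h : set g) (n : nat) :
    set g :=
  iter n (fun A => bracket_subgroup A h) h.

Definition soluble (g : lieRingType) (h : set g) : Prop :=
  exists n : nat, derived_series h n = [set 0].

Definition nilpotent (g : lieRingType) (h : set g) : Prop :=
  exists n : nat, lower_central_series h n = [set 0].

Definition normaliser (g : lieRingType) (h : set g) : set g :=
  [set x | forall y : g, h y -> h (bracket x y)].

(** * The hereditary chain condition on centralisers *)

Definition centraliser_mod (g : lieRingType) (s : seq g) (N : set g) : set g :=
  [set x | forall y : g, y \in s -> N (bracket x y)].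

Definition cosets (V : zmodType) (A B : set V) : set (set V) :=
  [set [set a + b | b in B] | a in A].

Definition index_ge (V : zmodType) (A B : set V) (d : nat) : Prop :=
  `I_d #<= cosets A B.

(** For [i = 0] the larger centraliser is the whole Lie ring. *)
Definition hereditarily_Mc (L : language) (M : fo_structure L)
    (g : lieRingType) (D : definable_lie_ring M g) : Prop :=
  forall N : set g, subgroup N -> definable_subset D N ->
  exists n d : nat,
    ~ exists s : n.-tuple g, forall i : nat, (i < n)%N ->
        index_ge (centraliser_mod (take i s) N)
                 (centraliser_mod (take i.+1 s) N) d.

(* Main.v *)
Require Import Defs.
From HB Require Import structures.
From mathcomp Require Import all_boot all_algebra.
From mathcomp Require Import boolp classical_sets functions cardinality.
From mathcomp Require Import zify.

Set Implicit Arguments.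
Unset Strict Implicit.
Unset Printing Implicit Defensive.

Import GRing.Theory.
Local Open Scope classical_set_scope.
Local Open Scope ring_scope.

(** Say that [A] is virtually contained in [W] if finitely many cosets of [W]
    cover [A].  The almost centraliser of a subgroup [h] modulo a definable
    subgroup [W] is the set [Z] of those [x] for which [[x, h]] is virtually
    contained in [W].  The chain condition bounds these finite quantities
    uniformly, so by B. H. Neumann's covering lemma the set [h0] of the [y] in [h]
    with [[Z, y]] finite modulo [W] has finite index in [h], and by
    P. M. Neumann's argument [[Z, h0]] is finite modulo [W].  It follows that [Z]
    is definable, even though [h] need not be.  Moreover the Jacobi identity shows
    that [Z] is stable under every derivation preserving [h] and [W].

    Let [h] be nilpotent modulo an ideal [N] definable in the big ring.  We build
    a chain [N = W_0 <= ... <= W_m] of definable subgroups with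
    [[W_(i+1), h] <= W_i] and [h <= W_m], going up the lower central series of
    [h].  Given the last rung [W], the subgroup [F = [Z, h0] + W] is finite modulo
    [W].  Put [Z1 = {x in Z | [x, h] <= F}] and [h1 = {y in h0 | [F, y] <= W}].
    Then [h] acts nilpotently, modulo [W], on [F1 = [Z1, h1] + W], and
    [{x in Z | [x, h] <= F1}] is definable because [h1] has finite index in [h];
    it contains all elements centralised by [h] modulo [W].  The elements of [W_m]
    that map each [W_(i+1)] into [W_i] form the required envelope.

    With [N = 0] this is the nilpotent case; the soluble case follows by applying
    it to the derived series from the bottom up, each term being abelian modulo
    the envelope of the next one. *)

(** * Definable sets *)

Section Renaming.
Variables (L : language) (M : fo_structure L).

Fixpoint term_rename (f : nat -> nat) (t : term L) : term L :=
  match t with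
  | Var i => Var L (f i)
  | App s args => App (fun j => term_rename f (args j))
  end.

Fixpoint rename (f : nat -> nat) (phi : formula L) : formula L :=
  match phi with
  | Bot => Bot L
  | Equal t u => Equal (term_rename f t) (term_rename f u)
  | Rel r args => Rel (fun j => term_rename f (args j))
  | Imp phi1 phi2 => Imp (rename f phi1) (rename f phi2)
  | Forall i phi1 => Forall (f i) (rename f phi1)
  end.

Lemma teval_rename f (v : nat -> M) t :
  teval v (term_rename f t) = teval (v \o f) t.
Proof.
by elim: t => //= s args IH; congr finterp; apply: funext => j; apply: IH.
Qed.

(** Bound variables are renamed too; injectivity of [f] prevents capture. *)
Lemma sat_rename f (v : nat -> M) phi :
  injective f -> sat v (rename f phi) <-> sat (v \o f) phi.
Proof.
move=> f_inj; elim: phi v => //=.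
- by move=> t u v; rewrite !teval_rename.
- move=> r args v; under eq_fun do rewrite teval_rename.
  by [].
- by move=> phi IH1 psi IH2 v; rewrite IH1 IH2.
- move=> i phi IH v.
  have E a : (fun j => if j == f i then a else v j) \o f =
      (fun j => if j == i then a else (v \o f) j).
    by apply: funext => j /=; rewrite (inj_eq f_inj).
  by split=> H a; move: (H a); rewrite IH E.
Qed.

(** In [merge w u] the even variables are the free ones and the odd ones carry
    parameters. *)
Definition merge T (w u : nat -> T) (p : nat) : T :=
  if odd p then u p./2 else w p./2.

Lemma merge_even T (w u : nat -> T) i : merge w u i.*2 = w i.
Proof. by rewrite /merge odd_double doubleK. Qed.

Lemma merge_odd T (w u : nat -> T) i : merge w u i.*2.+1 = u i.
Proof. by rewrite /merge /= odd_double /= uphalf_double. Qed.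

Definition pdef (P : (nat -> M) -> Prop) : Prop :=
  exists (phi : formula L) (u : nat -> M),
    forall w, P w <-> sat (merge w u) phi.

Lemma pdef_ext (P Q : (nat -> M) -> Prop) :
  (forall w, P w <-> Q w) -> pdef P -> pdef Q.
Proof. by move=> PQ [phi [u H]]; exists phi, u => w; rewrite -PQ. Qed.

Lemma pdef_not (P : (nat -> M) -> Prop) : pdef P -> pdef (fun w => ~ P w).
Proof. by case=> phi [u H]; exists (Imp phi (Bot L)), u => w /=; rewrite H. Qed.

Lemma pdef_imp (P Q : (nat -> M) -> Prop) :
  pdef P -> pdef Q -> pdef (fun w => P w -> Q w).
Proof.
move=> [phi [u H]] [psi [v K]].
(* The two formulas get disjoint parameter slots, the even ones for [u] and the odd ones for [v]. *)
pose f e p := if odd p then (e p./2).*2.+1 else p.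
have f_inj e : injective e -> injective (f e).
  by move=> e_inj p q; rewrite /f; case: ifP => ?; case: ifP => ? E;
    try (have := e_inj p./2 q./2); lia.
have fE e w u' : merge w u' \o f e = merge w (u' \o e).
  apply: funext => p; rewrite /f /=; case: (boolP (odd p)) => op.
    by rewrite merge_odd /merge op.
  by rewrite /merge (negbTE op).
exists (Imp (rename (f double) phi) (rename (f (fun p => p.*2.+1)) psi)).
exists (merge u v) => w /=.
rewrite !sat_rename; try by apply: f_inj => p q; lia.
rewrite !fE H K.
have -> : merge u v \o double = u.
  by apply: funext => p; rewrite /= merge_even.
have -> // : merge u v \o (fun p => p.*2.+1) = v.
by apply: funext => p; rewrite /= merge_odd.
Qed.

Lemma pdef_and (P Q : (nat -> M) -> Prop) :
  pdef P -> pdef Q -> pdef (fun w => P w /\ Q w).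
Proof.
move=> dP dQ; apply: pdef_ext (pdef_not (pdef_imp dP (pdef_not dQ))) => w.
split=> [H|[HP HQ] /(_ HP)//].
by split; apply: contrapT => K; apply: H => // ?.
Qed.

Lemma pdef_all (i : nat) (P : (nat -> M) -> Prop) : pdef P ->
  pdef (fun w => forall a, P (fun j => if j == i then a else w j)).
Proof.
move=> [phi [u H]]; exists (Forall i.*2 phi), u => w /=.
have E a : merge (fun j => if j == i then a else w j) u =
    (fun j => if j == i.*2 then a else merge w u j).
  apply: funext => p; rewrite /merge.
  by do ![case: ifP] => //; lia.
by split=> K a; have := K a; rewrite H E.
Qed.

Lemma pdef_comp s (P : (nat -> M) -> Prop) : injective s -> pdef P ->
  pdef (fun w => P (w \o s)).
Proof.
move=> s_inj [phi [u H]].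
pose f p := if odd p then p else (s p./2).*2.
have f_inj : injective f.
  by move=> p q; rewrite /f; case: ifP => ?; case: ifP => ? E;
    try (have := s_inj p./2 q./2); lia.
exists (rename f phi), u => w; rewrite H sat_rename //.
have -> // : merge w u \o f = merge (w \o s) u.
apply: funext => p; rewrite /f /=; case: (boolP (odd p)) => op.
  by rewrite /merge op.
by rewrite merge_even /merge (negbTE op).
Qed.

Lemma pdef_fix (S : pred nat) c (P : (nat -> M) -> Prop) : pdef P ->
  pdef (fun w => P (fun p => if S p then c p else w p)).
Proof.
move=> [phi [u H]].
(* Old parameters move to the odd parameter slots and the variables in [S] to the even ones, where
   [merge c u] supplies their fixed values. *)
pose f p := if odd p then (p./2.*2.+1).*2.+1
            else if S p./2 then p./2.*2.*2.+1 else p.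
have f_inj : injective f.
  move=> p q; rewrite /f.
  case: (boolP (odd p)) => ?; case: (boolP (odd q)) => ?;
    do ?case: ifP; lia.
exists (rename f phi), (merge c u) => w; rewrite H sat_rename //.
set v := merge _ u; have -> // : merge w (merge c u) \o f = v.
apply: funext => p; rewrite /v /f /=; case: (boolP (odd p)) => op.
  by rewrite !merge_odd /merge op.
rewrite [RHS]/merge (negbTE op); case: ifP => Sp; last by rewrite /merge (negbTE op).
by rewrite merge_odd merge_even.
Qed.

Lemma pdef_all_block (m0 : M) o n (P : (nat -> M) -> Prop) : pdef P ->
  pdef (fun w => forall b : nat -> M,
    P (fun p => if (o <= p < o + n)%N then b p else w p)).
Proof.
move=> dP; elim: n => [|n IH].
  apply: pdef_ext dP => w.
  have E b : (fun p => if (o <= p < o + 0)%N then b p else w p) = w.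
    by apply: funext => p; case: ifP => //; lia.
  by split=> [H b|/(_ (fun=> m0))]; rewrite E.
apply: pdef_ext (pdef_all (o + n) IH) => w; split=> [H b|H a b].
  have := H (b (o + n)%N) b; congr P; apply: funext => p.
  by case: eqP => [->|?]; do !case: ifP => //; lia.
have := H (fun p => if p == (o + n)%N then a else b p).
congr P; apply: funext => p.
by case: (p =P _) => [->|?]; do !case: ifP => //; lia.
Qed.

Lemma pdef_definable n (X : set (n.-tuple M)) : definable X ->
  pdef (fun w => X [tuple w i | i < n]).
Proof.
move=> [phi [v ->]].
pose f p := if (p < n)%N then p.*2 else p.*2.+1.
have f_inj : injective f by move=> p q; rewrite /f; do !case: ifP; lia.
exists (rename f phi), v => w; rewrite sat_rename //=.
set v1 := fun i => _; have -> // : v1 = merge w v \o f.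
apply: funext => p; rewrite /v1 /f /=.
case: (ltnP p n) => pn.
  by rewrite merge_even (nth_mktuple _ _ (Ordinal pn)).
by rewrite merge_odd nth_default // size_map size_enum_ord.
Qed.

Lemma definable_pdef (m0 : M) n (P : (nat -> M) -> Prop) : pdef P ->
  definable [set x : n.-tuple M | P (fun p => nth m0 x p)].
Proof.
move=> [phi [u H]].
(* Free variables beyond the tuple become parameters with value [m0], the default of [nth]. *)
pose f p := if ~~ odd p && (p./2 < n)%N then p./2 else (n + p)%N.
have f_inj : injective f by move=> p q; rewrite /f; do !case: ifP; lia.
exists (rename f phi), (fun p => if odd (p - n) then u (p - n)./2 else m0).
apply: funext => x /=; apply: propext; rewrite H sat_rename //=.
set w1 := merge _ _; set w2 := _ \o _; have -> // : w1 = w2.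
apply: funext => p; rewrite /w1 /w2 /merge /f /=.
case: (boolP (odd p)) => op /=.
  by rewrite nth_default ?size_tuple ?addKn ?op //; lia.
case: ltnP => pn; first by apply: set_nth_default; rewrite size_tuple.
by rewrite !nth_default ?size_tuple ?addKn ?(negbTE op) //; lia.
Qed.

End Renaming.

(** * Definable subsets of a definable Lie ring *)

Definition addset (V : zmodType) (X Y : set V) : set V :=
  [set x + y | x in X & y in Y].

Section DefinableSubsets.
Variables (L : language) (M : fo_structure L) (g : lieRingType).
Variable D : definable_lie_ring M g.

Let k := arity D.

Lemma exists_dom : M.
Proof.
have [phi H] := cid (definable_carrier D); have [v _] := cid H; exact: (v 0%N).
Qed.

(** The [g]-valued variable [i] is spread over the [M]-valued variables
    [i * k, ..., i * k + k - 1]. *)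
Definition flat (w : nat -> g) (p : nat) : M :=
  nth exists_dom (coords D (w (p %/ k)%N)) (p %% k)%N.

Definition upd (w : nat -> g) (i : nat) a : nat -> g :=
  fun j => if j == i then a else w j.

Lemma flat_upd w i a : flat (upd w i a) = fun p =>
  if (i * k <= p < i * k + k)%N then nth exists_dom (coords D a) (p - i * k)%N
  else flat w p.
Proof.
apply: funext => p; rewrite /flat /upd.
have [k0|k0] := posnP k.
  have nk (t : k.-tuple M) q : nth exists_dom t q = exists_dom.
    by rewrite nth_default // size_tuple k0.
  by rewrite !nk if_same.
have pE := divn_eq p k; have pk := ltn_pmod p k0.
case: eqP => [pi|pi].
  by rewrite ifT; [congr nth; lia | nia].
by rewrite ifF //; apply/negP => /andP[? ?]; apply: pi; nia.
Qed.

Lemma block_flat w i (n : nat) (nk : n = k) (j : 'I_n) :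
  flat w (i * k + j)%N = tnth (coords D (w i)) (cast_ord nk j).
Proof.
have jk : (j < k)%N by case: j => /= j; rewrite nk.
rewrite /flat divnMDl ?(leq_ltn_trans _ jk) // divn_small // addn0.
by rewrite modnMDl modn_small // (tnth_nth exists_dom).
Qed.

(** [P] is constrained on flattened assignments only, so a quantifier over [g] has to be relativised
    to the range of [coords]. *)
Definition gdef (R : (nat -> g) -> Prop) : Prop :=
  exists2 P : (nat -> M) -> Prop, pdef P & forall w, R w <-> P (flat w).

Lemma gdef_ext (P Q : (nat -> g) -> Prop) :
  (forall w, P w <-> Q w) -> gdef P -> gdef Q.
Proof. by move=> PQ [R dR H]; exists R => // w; rewrite -PQ. Qed.

Lemma gdef_not (P : (nat -> g) -> Prop) : gdef P -> gdef (fun w => ~ P w).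
Proof.
by move=> [R dR H]; exists (fun w => ~ R w) => [|w]; [exact: pdef_not|rewrite H].
Qed.

Lemma gdef_imp (P Q : (nat -> g) -> Prop) :
  gdef P -> gdef Q -> gdef (fun w => P w -> Q w).
Proof.
move=> [R dR H] [S dS K]; exists (fun w => R w -> S w) => [|w].
  exact: pdef_imp.
by rewrite H K.
Qed.

Lemma gdef_and (P Q : (nat -> g) -> Prop) :
  gdef P -> gdef Q -> gdef (fun w => P w /\ Q w).
Proof.
move=> [R dR H] [S dS K]; exists (fun w => R w /\ S w) => [|w].
  exact: pdef_and.
by rewrite H K.
Qed.

Lemma pdef_carrier i :
  pdef (fun w : nat -> M => range (coords D) [tuple w (i * k + j)%N | j < k]).
Proof.
have /(pdef_comp (s := fun p => (i * k + p)%N)) := pdef_definable (definable_carrier D).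
by apply=> p q; lia.
Qed.

Lemma gdef_all (i : nat) (R : (nat -> g) -> Prop) : gdef R ->
  gdef (fun w => forall a, R (upd w i a)).
Proof.
move=> [P dP H].
exists (fun w => forall b : nat -> M,
  (fun w' => range (coords D) [tuple w' (i * k + j)%N | j < k] -> P w')
    (fun p => if (i * k <= p < i * k + k)%N then b p else w p)).
  by have := pdef_all_block exists_dom (i * k) k (pdef_imp (pdef_carrier i) dP).
move=> w; split=> [K b [a _ aE]|K a].
  have := K a; rewrite H flat_upd aE; congr P; apply: funext => p.
  case: ifP => // pi.
  have pk : (p - i * k < k)%N by lia.
  rewrite (nth_mktuple _ _ (Ordinal pk)) /= ifT; last by lia.
  by congr b; lia.
rewrite H flat_upd; apply: (K (fun p => nth _ _ _)); exists a => //.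
apply: eq_from_tnth => j; rewrite tnth_mktuple ifT; last first.
  by rewrite leq_addr ltn_add2l ltn_ord.
by rewrite addKn (tnth_nth exists_dom).
Qed.

Lemma gdef_ex (i : nat) (R : (nat -> g) -> Prop) : gdef R ->
  gdef (fun w => exists a, R (upd w i a)).
Proof.
move=> /gdef_not/(gdef_all i)/gdef_not; apply: gdef_ext => w.
by split=> [/existsNP[a /contrapT Ra]|[a Ra] H]; [exists a|exact: (H a)].
Qed.

Lemma gdef_fix (i : nat) a (R : (nat -> g) -> Prop) : gdef R ->
  gdef (fun w => R (upd w i a)).
Proof.
move=> [P dP H].
exists (fun w => P (fun p => if (i * k <= p < i * k + k)%N
                     then nth exists_dom (coords D a) (p - i * k)%N else w p)).
  exact: (pdef_fix _ _ dP).
by move=> w; rewrite H flat_upd.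
Qed.

Lemma gdef_set i (X : set g) :
  definable_subset D X -> gdef (fun w => X (w i)).
Proof.
move=> dX; exists (fun w => (coords D @` X) [tuple w (i * k + j)%N | j < k]).
  have /(pdef_comp (s := fun p => (i * k + p)%N)) := pdef_definable dX.
  by apply=> p q; lia.
move=> w; have -> : [tuple flat w (i * k + j)%N | j < k] = coords D (w i).
  apply: eq_from_tnth => j.
  by rewrite tnth_mktuple (block_flat _ _ (erefl k)) cast_ord_id.
by split=> [Xi|[a Xa /coords_inj <-]//]; exists (w i).
Qed.

Lemma gdef_graph (op : g -> g -> g) (i1 i2 i3 : nat) :
  definable (range (fun p : g * g =>
    [tuple of coords D p.1 ++ coords D p.2 ++ coords D (op p.1 p.2)])) ->
  uniq [:: i1; i2; i3] ->
  gdef (fun w => op (w i1) (w i2) = w i3).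
Proof.
rewrite -/k => /pdef_definable dG /= i_uniq.
(* The three blocks of a point of the graph go to the blocks [i1], [i2], [i3]; the last clause only
   makes [s] injective, as [pdef_comp] requires. *)
pose s p := if (p < k)%N then (i1 * k + p)%N else
  if (p < k + k)%N then (i2 * k + (p - k))%N else
  if (p < k + (k + k))%N then (i3 * k + (p - (k + k)))%N
  else (p + (i1 + i2 + i3) * k)%N.
have blk i j p q : (p < k -> q < k -> i * k + p = j * k + q -> i = j /\ p = q)%N.
  move=> pk qk E; have ij : i = j.
    have k0 := leq_ltn_trans (leq0n p) pk.
    move: (congr1 (divn^~ k) E).
    by rewrite !divnMDl // !divn_small // !addn0.
  by move: E; rewrite ij => /addnI.
have s_inj : injective s.
  move: i_uniq; rewrite !inE !negb_or.
  move=> /andP[/andP[/eqP n12 /eqP n13] /andP[/eqP n23 _]].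
  have b1 p q : (p < k + k -> k <= p -> q < k -> i1 * k + q <> i2 * k + (p - k))%N.
    by move=> ? ? ? /blk[]//; lia.
  have b2 p q : (p < k + (k + k) -> k + k <= p -> q < k ->
      i1 * k + q <> i3 * k + (p - (k + k)))%N.
    by move=> ? ? ? /blk[]//; lia.
  have b3 p q : (p < k + (k + k) -> k + k <= p -> q < k + k -> k <= q ->
      i2 * k + (q - k) <> i3 * k + (p - (k + k)))%N.
    by move=> ? ? ? ? /blk[]//; lia.
  move=> p q; rewrite /s; rewrite !mulnDl.
  move: (b1 p q) (b1 q p) (b2 p q) (b2 q p) (b3 p q) (b3 q p).
  move: (i1 * k)%N (i2 * k)%N (i3 * k)%N => x1 x2 x3.
  by do !case: ltnP => ?; lia.
have {dG} := pdef_comp s_inj dG; set P := (fun w : nat -> M => _) => dP.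
exists P => // w.
have E : [tuple (flat w \o s) i | i < (k + (k + k))%N] =
    [tuple of coords D (w i1) ++ coords D (w i2) ++ coords D (w i3)].
  apply: eq_from_tnth => j; rewrite tnth_mktuple (tnth_nth exists_dom) /=.
  rewrite !nth_cat !size_tuple /s; have := ltn_ord j.
  have fE i (l : nat) : (l < k)%N ->
      flat w (i * k + l)%N = nth exists_dom (coords D (w i)) l.
    move=> lk; rewrite (block_flat w i (erefl k) (Ordinal lk)) cast_ord_id.
    by rewrite (tnth_nth exists_dom).
  move: (nat_of_ord j) => l lk; rewrite -/k; case: ltnP => [?|lk1]; first exact: fE.
  have -> : (l - k < k)%N = (l < k + k)%N by lia.
  case: ltnP => [?|?]; first by apply: fE; lia.
  by rewrite lk fE ?subnDA //; lia.
have cat_inj (t t' : k.-tuple M) (s1 s2 : seq M) :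
    t ++ s1 = t' ++ s2 -> t = t' /\ s1 = s2.
  move=> H; split; last by have := congr1 (drop k) H; rewrite !drop_size_cat ?size_tuple.
  by apply: val_inj; have := congr1 (take k) H; rewrite !take_size_cat ?size_tuple.
rewrite /P E; split=> [wE|[[a b] _ /= /(congr1 val) /=]].
  by exists (w i1, w i2); rewrite //= wE.
by move=> /cat_inj[/coords_inj<- /cat_inj[/coords_inj<- /val_inj/coords_inj<-]].
Qed.

Lemma definable_gdef (X : set g) :
  gdef (fun w => X (w 0%N)) -> definable_subset D X.
Proof.
move=> [P dP H].
(* Variables outside the first block are frozen at the coordinates of 0; the second conjunct keeps
   the point inside the carrier. *)
have /(definable_pdef exists_dom k) :=
  pdef_and (pdef_fix (fun p => ~~ (0 * k <= p < 0 * k + k)%N) (flat (fun=> 0)) dP)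
    (pdef_carrier 0).
rewrite /definable_subset; congr definable; rewrite predeqE => x /=.
have E a : (fun p => if ~~ (0 * k <= p < 0 * k + k)%N then flat (fun=> 0) p
                      else nth exists_dom (coords D a) p) =
    flat (upd (fun=> 0) 0 a).
  rewrite flat_upd; apply: funext => p.
  by rewrite mul0n subn0 if_neg.
have T : [tuple nth exists_dom x (0 * k + j)%N | j < k] = x.
  by apply: eq_from_tnth => j; rewrite tnth_mktuple (tnth_nth exists_dom).
rewrite T; split=> [[Px [a _ ax]]|[a Xa <-]].
  by exists a => //; move: Px; rewrite -ax E -H.
by rewrite E -H /upd; split => //; exists a.
Qed.

Lemma definable_setI (X Y : set g) :
  definable_subset D X -> definable_subset D Y -> definable_subset D (X `&` Y).
Proof.
by move=> dX dY; apply: definable_gdef; apply: gdef_and; apply: gdef_set.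
Qed.

Lemma definable_set1 (a : g) : definable_subset D [set a].
Proof.
apply: definable_gdef.
(* Equality with [a] is expressed as [a + 0 = w 0]. *)
have := gdef_graph (i1 := 1%N) (i2 := 2%N) (i3 := 0%N) (definable_add D) isT.
move=> /(gdef_fix 1%N a)/(gdef_fix 2%N 0); apply: gdef_ext => w.
by rewrite /upd /= addr0; split=> ->.
Qed.

Lemma definable_seq (s : seq g) : definable_subset D [set` s].
Proof.
elim: s => [|a s IH]; apply: definable_gdef.
  have /(gdef_set 0%N) dH := definable_set1 0.
  apply: gdef_ext (gdef_and dH (gdef_not dH)) => w.
  by split=> // -[].
have /(gdef_set 0%N) dH := definable_set1 a.
apply: gdef_ext (gdef_imp (gdef_not dH) (gdef_set 0%N IH)) => w /=.
rewrite in_cons; split=> [H|/orP[/eqP//|//]].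
by case: eqP => //= /H.
Qed.

Lemma definable_addset (X Y : set g) :
  definable_subset D X -> definable_subset D Y -> definable_subset D (addset X Y).
Proof.
move=> dX dY; apply: definable_gdef.
have dA := gdef_graph (i1 := 1%N) (i2 := 2%N) (i3 := 0%N) (definable_add D) isT.
have dXY := gdef_and (gdef_set 1%N dX) (gdef_set 2%N dY).
have := gdef_ex 1%N (gdef_ex 2%N (gdef_and dA dXY)).
apply: gdef_ext => w; rewrite /upd /=.
split=> [[x [y [<- [Xx Yy]]]]|[x Xx [y Yy <-]]]; first by exists x => //; exists y.
by exists x, y.
Qed.

(** [C(X/Y)] in the notation of the paper. *)
Definition centr (X Y : set g) : set g :=
  [set x | forall y, X y -> Y (bracket x y)].

Lemma definable_centr (X Y : set g) :
  definable_subset D X -> definable_subset D Y -> definable_subset D (centr X Y).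
Proof.
move=> dX dY; apply: definable_gdef.
have dB := gdef_graph (i1 := 0%N) (i2 := 1%N) (i3 := 2%N) (definable_bracket D) isT.
have dXY := gdef_imp (gdef_set 1%N dX) (gdef_set 2%N dY).
have := gdef_all 1%N (gdef_all 2%N (gdef_imp dB dXY)).
apply: gdef_ext => w; rewrite /upd /=.
by split=> [H y Xy|H y z <- Xy]; [exact: (H y _ erefl)|exact: H].
Qed.

End DefinableSubsets.

(** * Subgroups up to finite index *)

Section Covering.
Variable V : zmodType.
Implicit Types (A B W X Y : set V) (n m : nat).

Lemma subgroup0 A : subgroup A -> A 0. Proof. by case. Qed.

Lemma subgroupB A x y : subgroup A -> A x -> A y -> A (x - y).
Proof. by case=> _; apply. Qed.

Lemma subgroupN A x : subgroup A -> A x -> A (- x).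
Proof. by move=> sA Ax; rewrite -sub0r; apply: subgroupB => //; case: sA. Qed.

Lemma subgroupNE A x : subgroup A -> A (- x) <-> A x.
Proof.
by move=> sA; split=> /(subgroupN sA) //; rewrite opprK.
Qed.

Lemma subgroupD A x y : subgroup A -> A x -> A y -> A (x + y).
Proof.
by move=> sA Ax Ay; rewrite -[y]opprK; apply: subgroupB => //; apply: subgroupN.
Qed.

Lemma subgroupI A B : subgroup A -> subgroup B -> subgroup (A `&` B).
Proof.
move=> sA sB; split=> [|x y [Ax Bx] [Ay By]].
  by split; apply: subgroup0.
by split; apply: subgroupB.
Qed.

Lemma subgroup_addset A B : subgroup A -> subgroup B -> subgroup (addset A B).
Proof.
move=> sA sB; split=> [|_ _ [a Aa [b Bb <-]] [c Ac [d Bd <-]]].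
  by exists 0; [exact: subgroup0|exists 0; [exact: subgroup0|rewrite addr0]].
exists (a - c); first exact: subgroupB.
by exists (b - d); [exact: subgroupB|rewrite opprD addrACA].
Qed.

Lemma sub_addsetl A B : subgroup B -> A `<=` addset A B.
Proof. by move=> sB a Aa; exists a => //; exists 0; rewrite ?addr0 //; case: sB. Qed.

Lemma sub_addsetr A B : subgroup A -> B `<=` addset A B.
Proof. by move=> sA b Bb; exists 0; [case: sA|exists b; rewrite ?add0r]. Qed.

Lemma addset_sub A B C : subgroup C -> A `<=` C -> B `<=` C -> addset A B `<=` C.
Proof. by move=> sC AC BC _ [a /AC Ca [b /BC Cb <-]]; apply: subgroupD. Qed.

Definition covered_by n X W : Prop :=
  exists2 r : seq V, (size r <= n)%N &
    forall x, X x -> exists2 b, b \in r & W (x - b).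

Definition virtually_sub X W : Prop := exists n, covered_by n X W.

(** The packing count dual to [covered_by]: for a subgroup [W], having no [n.+1] separated points
    amounts to being covered by [n] cosets. *)
Definition separated n X W : Prop :=
  exists2 t : nat -> V, (forall i, (i < n)%N -> X (t i)) &
    forall i j, (i < j < n)%N -> ~ W (t j - t i).

Lemma covered_byS n X X' W W' :
  X' `<=` X -> W `<=` W' -> covered_by n X W -> covered_by n X' W'.
Proof.
move=> XX' WW' [r rn H]; exists r => // x /XX' /H[b br /WW']; by exists b.
Qed.

Lemma virtually_subS X X' W W' :
  X' `<=` X -> W `<=` W' -> virtually_sub X W -> virtually_sub X' W'.
Proof. by move=> XX' WW' [n H]; exists n; apply: covered_byS H. Qed.


Lemma nat_max_prefix (P : nat -> Prop) n : P 0%N -> ~ P n.+1 ->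
  exists2 m, P m & ~ P m.+1.
Proof.
move=> P0; elim: n => [|n IH] nP; first by exists 0%N.
by have [Pn|/IH//] := pselect (P n.+1); exists n.+1.
Qed.

Lemma separated0 X W : separated 0 X W.
Proof. by exists (fun=> 0) => // i j; rewrite ltn0 andbF. Qed.

Lemma separated_rcons n X W t x :
  (forall i, (i < n)%N -> X (t i)) ->
  (forall i j, (i < j < n)%N -> ~ W (t j - t i)) ->
  X x -> (forall i, (i < n)%N -> ~ W (x - t i)) -> separated n.+1 X W.
Proof.
move=> tX tW Xx xW; exists (fun i => if i == n then x else t i) => [i|i j ij].
  by case: eqP => // ? ?; apply: tX; lia.
case: (i =P n) => ?; first by lia.
by case: (j =P n) => ?; [apply: xW|apply: tW]; lia.
Qed.

(** A separated family of maximal size is a system of representatives, since no further point is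
    incongruent to all its members. *)
Lemma not_separated_covered n X W : ~ separated n.+1 X W -> covered_by n X W.
Proof.
move=> nsep.
have [m [t tX tW] msep] : exists2 m, separated m X W & ~ separated m.+1 X W.
  exact: nat_max_prefix (separated0 X W) nsep.
have mn : (m <= n)%N.
  rewrite leqNgt; apply/negP => nm; apply: nsep; exists t => [i ?|i j ?].
    by apply: tX; lia.
  by apply: tW; lia.
exists [seq t i | i <- iota 0 m]; first by rewrite size_map size_iota.
move=> x Xx; apply: contrapT => H; apply: msep.
apply: (separated_rcons tX tW Xx) => i im Wxt; apply: H; exists (t i) => //.
by apply: map_f; rewrite mem_iota.
Qed.

Lemma covered_not_separated n X W :
  subgroup W -> covered_by n X W -> ~ separated n.+1 X W.
Proof.
move=> sW [r rn H] [t tX tW].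
have /choice[b bP] : forall i, exists b, (i < n.+1)%N -> b \in r /\ W (t i - b).
  move=> i; have [/tX/H[b br Wb]|ni] := pselect (i < n.+1)%N; first by exists b.
  by exists 0.
have : (size [seq b i | i <- iota 0 n.+1] <= size r)%N.
  apply: uniq_leq_size; last first.
    by move=> c /mapP[i]; rewrite mem_iota => /andP[_ ?] ->; case: (bP i).
  rewrite map_inj_in_uniq ?iota_uniq // => i j; rewrite !mem_iota => ? ? bij.
  have WD : W (t i - t j) /\ W (t j - t i).
    have [_ Wi] := bP i ltac:(lia); have [_ Wj] := bP j ltac:(lia).
    have E k l : t k - t l = (t k - b i) - (t l - b i).
      by rewrite opprB addrA subrK.
    by split; rewrite E; apply: subgroupB; rewrite // bij.
  case: WD => Wij Wji; case: (ltngtP i j) => // ij.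
    by case: (tW i j) => //; lia.
  by case: (tW j i) => //; lia.
by rewrite size_map size_iota; lia.
Qed.

Lemma covered_by_trans n m X Y W :
  covered_by n X Y -> covered_by m Y W -> covered_by (n * m) X W.
Proof.
move=> [r rn H] [s sm K]; exists [seq b + c | b <- r, c <- s].
  by rewrite size_allpairs leq_mul.
move=> x /H[b br /K[c cs Wc]]; exists (b + c); last by rewrite opprD addrA.
by apply/allpairsP; exists (b, c).
Qed.

Lemma virtually_sub_trans X Y W :
  virtually_sub X Y -> virtually_sub Y W -> virtually_sub X W.
Proof. by move=> [n H] [m K]; exists (n * m)%N; apply: covered_by_trans H K. Qed.

Lemma virtually_sub_refl X W : X `<=` W -> virtually_sub X W.
Proof.
by move=> XW; exists 1%N, [:: 0] => // x /XW Wx; exists 0; rewrite ?inE ?subr0.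
Qed.

(** A coset meeting [X] is represented by one of its points in [X]; the other cosets are dropped. *)
Lemma covered_by_inside n X W : subgroup W -> covered_by n X W ->
  exists r : seq V, [/\ (size r <= n)%N, forall b, b \in r -> X b &
    forall x, X x -> exists2 b, b \in r & W (x - b)].
Proof.
move=> sW [r rn H].
have /choice[f fP] : forall b, exists y,
    (exists2 x, X x & W (x - b)) -> X y /\ W (y - b).
  move=> b; have [[x Xx Wx]|nx] := pselect (exists2 x, X x & W (x - b)).
    by exists x.
  by exists 0.
exists [seq f b | b <- r & `[< exists2 x, X x & W (x - b) >]]; split.
- by rewrite size_map size_filter (leq_trans (count_size _ _)).
- by move=> c /mapP[b]; rewrite mem_filter => /andP[/asboolP /fP[? _] _] ->.
move=> x Xx; have [b br Wb] := H x Xx.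
have bP : exists2 x, X x & W (x - b) by exists x.
exists (f b); first by apply: map_f; rewrite mem_filter br andbT; apply/asboolP.
have [_ Wf] := fP b bP.
by have := subgroupB sW Wb Wf; rewrite opprB addrA subrK.
Qed.

Lemma virtually_subI A B W : subgroup A -> subgroup B -> subgroup W ->
  virtually_sub A B -> virtually_sub A W -> virtually_sub A (B `&` W).
Proof.
move=> sA sB sW [n /(covered_by_inside sB)[r [rn rA rB]]] [m AW].
have [] := @covered_by_inside m (A `&` B) W sW.
  by apply: covered_byS AW => // x [].
move=> s [sm sAB sP]; exists (n * m)%N, [seq b + c | b <- r, c <- s].
  by rewrite size_allpairs leq_mul.
move=> x Ax; have [b br Bb] := rB x Ax.
have [c cs Wc] : exists2 c, c \in s & W (x - b - c).
  by apply: sP; split=> //; apply: subgroupB => //; apply: rA.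
exists (b + c); first by apply/allpairsP; exists (b, c).
rewrite opprD addrA; split=> //; apply: subgroupB => //; by case: (sAB c cs).
Qed.

(** B. H. Neumann: if some coset of [H i] is missing from a finite cover of [B],
    then it is covered by cosets of the other subgroups; hence so is every coset
    of [H i], and [H i] can be dropped from the cover. *)
Lemma neumann_covering (I : eqType) (H : I -> set V) (s : seq I) B (r : seq V) :
  subgroup B -> (forall i, subgroup (H i)) ->
  (forall b, B b -> exists2 i, i \in s & exists2 c, c \in r & H i (b - c)) ->
  exists2 i, i \in s & virtually_sub B (H i).
Proof.
move=> sB sH; elim: s r => [|i s IH] r cov.
  by have [i] := cov 0 (subgroup0 sB).
have [HB|nB] := pselect (forall b, B b -> exists2 c, c \in r & H i (b - c)).
  by exists i; [rewrite mem_head|exists (size r), r].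
have [y /existsNP[By nHy]] : exists y, ~ (B y -> exists2 c, c \in r & H i (y - c)).
  exact/existsNP.
have covI u : B u -> H i u ->
    exists2 j, j \in s & exists2 c, c \in r & H j (u - (c - y)).
  move=> Bu Hu; have [j] := cov (y + u) (subgroupD sB By Bu).
  rewrite inE => /orP[/eqP ->|js] [c cr Hc].
    case: nHy; exists c => //.
    by have := subgroupB (sH i) Hc Hu; rewrite addrAC addrK.
  by exists j => //; exists c => //; rewrite opprB addrA [u + y]addrC.
have /choice[f fP] : forall c, exists b0,
    (exists2 b, B b & H i (b - c)) -> B b0 /\ H i (b0 - c).
  move=> c; have [[b Bb Hb]|nb] := pselect (exists2 b, B b & H i (b - c)).
    by exists b.
  by exists 0.
have [] := IH (r ++ [seq f c + (c' - y) | c <- r, c' <- r]); last first.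
  by move=> j js ?; exists j; rewrite // inE js orbT.
move=> b Bb; have [j] := cov b Bb.
rewrite inE => /orP[/eqP ->|js] [c cr Hc]; last first.
  by exists j => //; exists c; rewrite // mem_cat cr.
have [Bf Hf] : B (f c) /\ H i (f c - c) by apply: fP; exists b.
have [] := covI (b - f c).
- exact: subgroupB.
- by have := subgroupB (sH i) Hc Hf; rewrite opprB addrA subrK.
move=> l ls [c' c'r Hc']; exists l => //; exists (f c + (c' - y)).
  by rewrite mem_cat; apply/orP; right; apply/allpairsP; exists (c, c').
by rewrite opprD addrA.
Qed.

(** Choose finitely many members of the family cutting [C] into as many pieces
    as possible. *)
Lemma finite_subintersection (I : eqType) (Y : set I) (P : I -> set V) C :
  subgroup C -> (forall i, subgroup (P i)) ->
  virtually_sub C (C `&` \bigcap_(i in Y) P i) ->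
  exists2 s : seq I, (forall i, i \in s -> Y i) &
    C `&` \bigcap_(i in Y) P i = C `&` \bigcap_(i in [set` s]) P i.
Proof.
move=> sC sP [n Hn].
pose Q (s : seq I) := C `&` \bigcap_(i in [set` s]) P i.
have sQ s : subgroup (Q s).
  apply: subgroupI => //; split=> [i _|x y Px Py i si].
    exact: subgroup0.
  by apply: subgroupB => //; [exact: Px|exact: Py].
pose R m := exists2 s : seq I, (forall i, i \in s -> Y i) & separated m C (Q s).
have [m [s sY [t tC tQ]] nR] : exists2 m, R m & ~ R m.+1.
  apply: (@nat_max_prefix _ n); first by exists [::] => //; exact: separated0.
  move=> [s sY]; apply: covered_not_separated => //.
  by apply: covered_byS Hn => // x [Cx Px]; split=> // i /sY; apply: Px.
have cs x : C x -> exists2 i, (i < m)%N & Q s (x - t i).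
  move=> Cx; apply: contrapT => H; apply: nR; exists s => //.
  by apply: (separated_rcons tC tQ Cx) => i im ?; apply: H; exists i.
exists s => //; apply/seteqP; split=> x [Cx Px]; split=> // i.
  by move=> /sY; apply: Px.
move=> Yi; apply: contrapT => nPx; apply: nR; exists (i :: s).
  by move=> j; rewrite inE => /orP[/eqP ->//|/sY].
have Qis : Q (i :: s) `<=` Q s.
  by move=> y [Cy Py]; split=> // j js; apply: Py; rewrite /= inE (js : j \in s) orbT.
have Qi : Q (i :: s) `<=` P i.
  by move=> y [_ Py]; apply: Py; rewrite /= mem_head.
have Qx : Q s x by [].
(* This only provides some index below [m]. The point [x + t i0] is congruent to [t i0] modulo [Q s]
   but not modulo [Q (i :: s)], so adjoining it to [t] contradicts the maximality of [m]. *)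
have [i0 i0m _] := cs 0 (subgroup0 sC).
have tQ' k l : (k < l < m)%N -> ~ Q (i :: s) (t l - t k).
  by move=> kl /Qis; apply: tQ.
apply: (@separated_rcons m C (Q (i :: s)) t (x + t i0) tC tQ').
  by apply: subgroupD => //; apply: tC.
move=> j jm; have [->|ji0] := eqVneq j i0; first by rewrite addrK => /Qi.
move=> /Qis Qxt; have Qt : Q s (t i0 - t j).
  by have := subgroupB (sQ s) Qxt Qx; rewrite addrAC [x + _]addrC addrK.
have [ji|ij|ij] := ltngtP j i0; last by rewrite ij eqxx in ji0.
  by apply: (tQ j i0) => //; rewrite ji i0m.
apply: (tQ i0 j); first by rewrite ij jm.
by rewrite -opprB; apply: subgroupN.
Qed.

End Covering.

(** * Biadditive maps with finite images *)

Section Biadditive.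
Variables (U V T : zmodType) (f : U -> V -> T).
Hypothesis fDl : forall x x' y, f (x + x') y = f x y + f x' y.
Hypothesis fDr : forall x y y', f x (y + y') = f x y + f x y'.
Variables (W : set T) (sW : subgroup W).
Implicit Types (A : set U) (B : set V).

Lemma biaddBl x x' y : f (x - x') y = f x y - f x' y.
Proof. by apply: (addIr (f x' y)); rewrite -fDl !subrK. Qed.

Lemma biaddBr x y y' : f x (y - y') = f x y - f x y'.
Proof. by apply: (addIr (f x y')); rewrite -fDr !subrK. Qed.

Lemma annr_subgroup x : subgroup [set y | W (f x y)].
Proof.
split=> [|y y' Wy Wy'] /=; last by rewrite biaddBr; apply: subgroupB.
by rewrite -(subrr 0) biaddBr subrr; exact: subgroup0.
Qed.

Lemma virtually_sub_annr x B : virtually_sub [set f x y | y in B] W ->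
  virtually_sub B [set y | W (f x y)].
Proof.
move=> [n /(covered_by_inside sW)[r [rn rB rP]]].
have /choice[c cP] : forall b, exists y, b \in r -> B y /\ f x y = b.
  move=> b; have [/rB[y By <-]|nb] := pselect (b \in r); first by exists y.
  by exists 0.
exists n, [seq c b | b <- r]; first by rewrite size_map.
move=> y By; have [|b br Wb] := rP (f x y); first by exists y.
exists (c b); first exact: map_f.
by have [_ cE] := cP b br; rewrite /= biaddBr cE.
Qed.

Lemma virtually_sub_imager x B : virtually_sub B [set y | W (f x y)] ->
  virtually_sub [set f x y | y in B] W.
Proof.
move=> [n [r rn rP]]; exists n, [seq f x b | b <- r]; first by rewrite size_map.
move=> _ [y /rP[b br Wb] <-]; exists (f x b); first exact: map_f.
by rewrite -biaddBr.
Qed.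

(** If [d.+1] points [t i] of [A] were incongruent, the annihilator in [B] of each difference
    [t j - t i] would have infinite index. By [neumann_covering] some [y] in [B] avoids all of
    these, and then the [d.+1] values [f (t i) y] are incongruent modulo [W]. *)
Lemma annihilator_symmetry A B d : subgroup B ->
  (forall y, B y -> covered_by d [set f x y | x in A] W) ->
  covered_by d A [set x | virtually_sub [set f x y | y in B] W].
Proof.
move=> sB H; apply: not_separated_covered => -[t tA tW].
pose K (p : nat * nat) := [set y | W (f (t p.2 - t p.1) y)].
pose s := [seq p <- [seq (i, j) | i <- iota 0 d.+1, j <- iota 0 d.+1] | (p.1 < p.2)%N].
have sP i j : (i < j < d.+1)%N -> (i, j) \in s.
  move=> ij; rewrite mem_filter; apply/andP; split; first by rewrite /=; lia.
  by apply/allpairsP; exists (i, j); split; rewrite ?mem_iota //=; lia.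
have [[p ps vB]|nv] := pselect (exists2 p, p \in s & virtually_sub B (K p)).
  have : (p.1 < p.2 < d.+1)%N.
    move: ps; rewrite mem_filter => /andP[p12 /allpairsP[[i j] /= [_ jd pE]]].
    move: jd; rewrite -[_ :: _]/(iota 0 d.+1) mem_iota.
    by move: p12; rewrite pE /=; lia.
  by move=> /tW; apply; apply: virtually_sub_imager.
have [y [By yK]] : exists y, B y /\ forall p, p \in s -> ~ K p y.
  apply: contrapT => ny; apply: nv.
  apply: (@neumann_covering _ _ K s B [:: 0]) => // [p|b Bb].
    exact: annr_subgroup.
  apply: contrapT => nb; apply: ny; exists b; split=> // p ps Kb; apply: nb.
  by exists p => //; exists 0; rewrite ?inE ?subr0.
apply: (covered_not_separated sW (H y By)).
exists (fun i => f (t i) y) => [i id|i j ij]; first by exists (t i) => //; exact: tA.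
by rewrite -biaddBl; apply: yK (i, j) (sP i j ij).
Qed.

Lemma virtually_sub_annr_seq B (s : seq U) : subgroup B ->
  (forall x, x \in s -> virtually_sub B [set y | W (f x y)]) ->
  virtually_sub B (\bigcap_(x in [set` s]) [set y | W (f x y)]).
Proof.
move=> sB; elim: s => [|x s IH] H.
  by apply: virtually_sub_refl => y _ z; rewrite /= in_nil.
have sI : subgroup (\bigcap_(z in [set` s]) [set y | W (f z y)]).
  split=> [z _|y y' Wy Wy' z zs]; first exact: (subgroup0 (annr_subgroup z)).
  by apply: (subgroupB (annr_subgroup z)); [exact: Wy|exact: Wy'].
have := virtually_subI sB (annr_subgroup x) sI (H x (mem_head _ _)).
move=> /(_ (IH _))[z zs|n]; first by apply: H; rewrite inE zs orbT.
move=> Hn; exists n; apply: covered_byS Hn => // y [Wy Wys] z /=.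
by rewrite inE => /orP[/eqP ->//|zs]; apply: Wys.
Qed.

Lemma finite_span A (ys : seq V) : subgroup A ->
  (forall y, y \in ys -> virtually_sub [set f x y | x in A] W) ->
  exists2 E : set T, [/\ subgroup E, W `<=` E & virtually_sub E W] &
    forall x y, A x -> y \in ys -> E (f x y).
Proof.
move=> sA; elim: ys => [|y ys IH] H.
  by exists W => //; split=> //; apply: virtually_sub_refl.
have [z zs|E [sE WE EW] EP] := IH; first by apply: H; rewrite inE zs orbT.
have sAy : subgroup [set f x y | x in A].
  split=> [|_ _ [x Ax <-] [x' Ax' <-]].
    exists 0; first exact: subgroup0.
    by rewrite -(subrr 0) biaddBl subrr.
  by exists (x - x'); [exact: subgroupB|rewrite biaddBl].
exists (addset [set f x y | x in A] E); last first.
  move=> x z Ax; rewrite inE => /orP[/eqP ->|zs].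
    by apply: sub_addsetl => //; exists x.
  by apply: sub_addsetr => //; apply: EP.
split; first exact: subgroup_addset.
  by move=> w /WE; apply: sub_addsetr.
have [n [r rn rP]] := EW; have [m [s sm sP]] := H y (mem_head _ _).
exists (m * n)%N, [seq b + c | b <- s, c <- r].
  by rewrite size_allpairs leq_mul.
move=> _ [u /sP[b bs Wb] [e /rP[c cr Wc] <-]].
exists (b + c); first by apply/allpairsP; exists (b, c).
by rewrite opprD addrACA; apply: subgroupD.
Qed.

(** P. M. Neumann's argument: if [f A y] has the largest possible number of
    elements modulo [W], realised by [f a_1 y, ..., f a_m y], then
    [f A z] is contained in [f A y] for every [z] annihilated by all the [a_i]. *)
Lemma neumann_bilinear A B d : subgroup A -> subgroup B ->
  (forall y, B y -> covered_by d [set f x y | x in A] W) ->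
  (forall x, A x -> virtually_sub [set f x y | y in B] W) ->
  exists2 E : set T, [/\ subgroup E, W `<=` E & virtually_sub E W] &
    forall x y, A x -> B y -> E (f x y).
Proof.
move=> sA sB Hd HA.
pose R m := exists2 y, B y & separated m [set f x y | x in A] W.
have [m [y By [t tA tW]] nR] : exists2 m, R m & ~ R m.+1.
  apply: (@nat_max_prefix _ d).
    by exists 0; [exact: subgroup0|exact: separated0].
  by case=> y By; apply: covered_not_separated => //; apply: Hd.
have /choice[a aP] : forall i, exists x, (i < m)%N -> A x /\ f x y = t i.
  move=> i; have [/tA[x Ax <-]|ni] := pselect (i < m)%N; first by exists x.
  by exists 0.
pose s := [seq a i | i <- iota 0 m].
have sP i : (i < m)%N -> a i \in s by move=> im; apply: map_f; rewrite mem_iota.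
have [n vB] : virtually_sub B (\bigcap_(x in [set` s]) [set z | W (f x z)]).
  apply: virtually_sub_annr_seq => // c /mapP[i]; rewrite mem_iota => /andP[_ im] ->.
  by apply/virtually_sub_annr/HA; case: (aP i im).
have sI : subgroup (\bigcap_(x in [set` s]) [set z | W (f x z)]).
  split=> [z _|u u' Wu Wu' z zs]; first exact: (subgroup0 (annr_subgroup z)).
  by apply: (subgroupB (annr_subgroup z)); [exact: Wu|exact: Wu'].
have [r [rn rB rP]] := covered_by_inside sI vB.
(* Including [f A b] for the representatives [b] in [r] reduces a general [z] to one that all the
   [a i] annihilate modulo [W]. *)
have [|E EW EP] := @finite_span A (y :: r) sA.
  move=> z; rewrite inE => /orP[/eqP->|/rB Bz]; by exists d; apply: Hd.
exists E => // x z Ax Bz; have [sE WE _] := EW.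
have [b br Ib] := rP z Bz.
rewrite -(subrK b z) addrC fDr; apply: subgroupD => //.
  by apply: EP; rewrite // inE br orbT.
have Bzb : B (z - b) by apply: subgroupB => //; exact: rB.
move: {z Bz b br} (z - b) Bzb Ib => z Bz Wz.
(* The values of the [a i] at [y + z] are congruent to the [t i], hence separated; as [m] is
   maximal, no further class can appear. *)
have [i im Wi] : exists2 i, (i < m)%N & W (f x (y + z) - f (a i) (y + z)).
  apply: contrapT => nx; apply: nR; exists (y + z); first exact: subgroupD.
  have WE' i : (i < m)%N -> W (f (a i) (y + z) - t i).
    move=> im; have [_ <-] := aP i im.
    by rewrite fDr addrAC subrr add0r; apply: Wz; exact: sP.
  apply: (@separated_rcons _ m _ _ (fun i => f (a i) (y + z)) (f x (y + z))).
  - by move=> i im; exists (a i) => //; case: (aP i im).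
  - move=> i j ij Wij; apply: (tW i j ij).
    have Wi := WE' i ltac:(lia); have Wj := WE' j ltac:(lia).
    have := subgroupD sW (subgroupB sW Wij Wj) Wi.
    by rewrite opprB [X in X + _]addrC !subrKA.
  - by exists x.
  - by move=> i im Wi; apply: nx; exists i.
have [Aa fa] := aP i im.
have Waz : W (f (a i) z) by apply: Wz; exact: sP.
(* [f x z] is the sum of [f x (y + z) - f (a i) (y + z)], [f (a i) z] and [f (a i - x) y]. *)
have := EP (a i - x) y (subgroupB sA Aa Ax) (mem_head _ _).
rewrite biaddBl => Eaxy.
have := subgroupD sE (subgroupD sE (WE _ Wi) (WE _ Waz)) Eaxy.
by rewrite !fDr opprD [_ + (- _ - _)]addrA subrK subrKA [f x y + _]addrC addrK.
Qed.

End Biadditive.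

(** * Almost centralisers *)

Section LieRing.
Variable g : lieRingType.
Implicit Types (A B W h N X Y : set g) (x y z d : g).

Let bracketDl' x x' y : bracket (x + x') y = bracket x y + bracket x' y.
Proof. exact: bracketDl. Qed.

Let bracketDr' x y y' : bracket x (y + y') = bracket x y + bracket x y'.
Proof. exact: bracketDr. Qed.

Let flipDl x x' y : bracket y (x + x') = bracket y x + bracket y x'.
Proof. exact: bracketDr. Qed.

Let flipDr x y y' : bracket (y + y') x = bracket y x + bracket y' x.
Proof. exact: bracketDl. Qed.

Lemma bracketBl x x' y : bracket (x - x') y = bracket x y - bracket x' y.
Proof. exact: (biaddBl bracketDl'). Qed.

Lemma bracketBr x y y' : bracket x (y - y') = bracket x y - bracket x y'.
Proof. exact: (biaddBr bracketDr'). Qed.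

Lemma bracket0r x : bracket x 0 = 0.
Proof. by rewrite -{1}(subrr 0) bracketBr subrr. Qed.

Lemma bracket0l x : bracket 0 x = 0.
Proof. by rewrite -{1}(subrr 0) bracketBl subrr. Qed.

Lemma bracketNr x y : bracket x (- y) = - bracket x y.
Proof. by rewrite -sub0r bracketBr bracket0r sub0r. Qed.

Lemma bracketNl x y : bracket (- x) y = - bracket x y.
Proof. by rewrite -sub0r bracketBl bracket0l sub0r. Qed.

Lemma bracketC_in W x y : subgroup W -> W (bracket x y) -> W (bracket y x).
Proof. by move=> sW; rewrite bracket_antisym => /(subgroupNE _ sW). Qed.

Lemma bracket_derivation d x y :
  bracket d (bracket x y) = bracket (bracket d x) y + bracket x (bracket d y).
Proof.
have /eqP := bracket_jacobi d x y.
rewrite (bracket_antisym y (bracket d x)) (bracket_antisym y d).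
by rewrite bracketNr -addrA -opprD subr_eq0 addrC => /eqP.
Qed.

(** The almost centraliser: equivalently, [C_h(x/W)] has finite index in [h]. *)
Definition acentr h W : set g :=
  [set x | virtually_sub [set bracket x y | y in h] W].

Lemma virtually_sub_bracketC W A x : subgroup W ->
  virtually_sub [set bracket y x | y in A] W <->
  virtually_sub [set bracket x y | y in A] W.
Proof.
move=> sW; have opp X : virtually_sub X W -> virtually_sub [set - x | x in X] W.
  move=> [n [r rn rP]]; exists n, [seq - b | b <- r]; first by rewrite size_map.
  move=> _ [z /rP[b br Wb] <-]; exists (- b); first exact: map_f.
  by rewrite -opprD; apply: subgroupN.
split=> /opp; apply: virtually_subS => // _ [y Ay <-].
  by exists (bracket y x); [exists y|rewrite -bracket_antisym].
by exists (bracket x y); [exists y|rewrite -bracket_antisym].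
Qed.

Lemma acentr_subgroup h W : subgroup W -> subgroup (acentr h W).
Proof.
move=> sW; split=> [|x x' [n [r rn rP]] [m [s sm sP]]].
  by apply: virtually_sub_refl => _ [y _ <-]; rewrite bracket0l; exact: subgroup0.
exists (n * m)%N, [seq b - c | b <- r, c <- s].
  by rewrite size_allpairs leq_mul.
move=> _ [y hy <-].
have [|b br Wb] := rP (bracket x y); first by exists y.
have [|c cs Wc] := sP (bracket x' y); first by exists y.
exists (b - c); first by apply/allpairsP; exists (b, c).
by rewrite bracketBl opprD addrACA -opprD; apply: subgroupB.
Qed.

Lemma acentrS h h' W : virtually_sub h h' -> acentr h' W `<=` acentr h W.
Proof.
move=> [n [r rn rP]] x; apply: virtually_sub_trans.
exists n, [seq bracket x b | b <- r]; first by rewrite size_map.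
move=> _ [y /rP[b br h'b] <-]; exists (bracket x b); first exact: map_f.
by exists (y - b); rewrite ?bracketBr.
Qed.

(** * The chain condition and the definability of almost centralisers *)

Section Definability.
Variables (L : language) (M : fo_structure L) (D : definable_lie_ring M g).
Hypothesis hMc : hereditarily_Mc D.
Variable W : set g.
Hypotheses (sW : subgroup W) (dW : definable_subset D W).

(** On [centraliser_mod s W] the kernel of [x -> [x, y]] modulo [W] is the smaller centraliser, so
    incongruent values come from distinct cosets. *)
Lemma separated_index_ge (s : seq g) y n :
  separated n [set bracket x y | x in centraliser_mod s W] W ->
  index_ge (centraliser_mod s W) (centraliser_mod (rcons s y) W) n.
Proof.
move=> [t tC tW].
have /choice[a aP] : forall i, exists x,
    (i < n)%N -> centraliser_mod s W x /\ bracket x y = t i.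
  move=> i; have [/tC[x Cx <-]|ni] := pselect (i < n)%N; first by exists x.
  by exists 0.
apply/pcard_leP/injfunPex.
exists (fun i => [set a i + b | b in centraliser_mod (rcons s y) W]).
  by move=> i /= /aP[Ca _]; exists (a i).
move=> i j; rewrite !inE /= => iN jN ij.
have C0 : centraliser_mod (rcons s y) W 0.
  by move=> z _; rewrite bracket0l; exact: subgroup0.
have Wd : W (t i - t j).
  have : [set a j + b | b in centraliser_mod (rcons s y) W] (a i).
    by rewrite -ij; exists 0; rewrite ?addr0.
  move=> [b Cb E].
  have [_ <-] := aP i iN; have [_ <-] := aP j jN.
  by rewrite -bracketBl -E addrC addKr; apply: Cb; rewrite mem_rcons mem_head.
have Wd' : W (t j - t i) by rewrite -opprB; apply: subgroupN.
case: (ltngtP i j) => // ij'; first by case: (tW i j); rewrite ?ij'.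
by case: (tW j i); rewrite ?ij'.
Qed.

(** The bound is the [d] of the chain condition, the same for all [S]: if no [s] worked, adjoining
    elements of [S] one by one would build a forbidden chain. *)
Lemma minimal_centraliser : exists n, forall S : set g,
  exists2 s : seq g, (forall y, y \in s -> S y) &
    forall y, S y -> covered_by n [set bracket x y | x in centraliser_mod s W] W.
Proof.
have [n [d nchain]] := hMc sW dW; exists d => S.
apply: contrapT => nS; apply: nchain.
suff [s [sn sS sP]] : exists s : seq g, [/\ size s = n, forall y, y \in s -> S y &
    forall i, (i < n)%N -> index_ge (centraliser_mod (take i s) W)
                             (centraliser_mod (take i.+1 s) W) d].
  by exists (Tuple (introT eqP sn)).
elim: (n) => [|m [s [sm sS sP]]]; first by exists [::].
have [y [Sy ncov]] : exists y, S y /\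
    ~ covered_by d [set bracket x y | x in centraliser_mod s W] W.
  apply: contrapT => ny; apply: nS; exists s => // y Sy.
  by apply: contrapT => ncov; apply: ny; exists y.
exists (rcons s y); split=> [|z|i].
- by rewrite size_rcons sm.
- by rewrite mem_rcons inE => /orP[/eqP->//|/sS].
rewrite ltnS leq_eqVlt => /orP[/eqP->|im].
  rewrite -sm -{1}cats1 take_size_cat // take_oversize ?size_rcons //.
  apply: separated_index_ge; apply: contrapT => nsep; apply: ncov.
  apply: not_separated_covered => sep; apply: nsep.
  move: sep => [t tX tW]; exists t => [k kd|k l kl]; first by apply: tX; lia.
  by apply: tW; lia.
by rewrite -!cats1 !takel_cat ?sm //; [exact: sP|lia].
Qed.

Variables (h : set g) (sh : subgroup h).

(** Take [s] in [acentr h W] from [minimal_centraliser]. The centraliser of [s] modulo [W] covers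
    [h] by [n] cosets, with [n] independent of [x], and the bracket with [x] takes at most [d]
    classes on each. *)
Lemma acentr_uniform : exists n, forall x,
  acentr h W x -> covered_by n [set bracket x y | y in h] W.
Proof.
have [d /(_ (acentr h W))[s sZ sP]] := minimal_centraliser.
have [n [r rn rP]] : virtually_sub h
    (\bigcap_(x in [set` s]) [set y | W (bracket x y)]).
  apply: (virtually_sub_annr_seq bracketDr') => // x /sZ Zx.
  exact: (virtually_sub_annr bracketDr').
exists (n * d)%N => x Zx; apply: covered_by_trans (sP x Zx).
exists [seq bracket x b | b <- r]; first by rewrite size_map.
move=> _ [y /rP[b br sb] <-]; exists (bracket x b); first exact: map_f.
exists (b - y) => [z zs|]; last first.
  by rewrite bracket_antisym -bracketNr opprB bracketBr.
apply: bracketC_in => //; rewrite -(opprB y) bracketNr.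
by apply: subgroupN => //; apply: sb.
Qed.

Let Z := acentr h W.
Let h0 := h `&` acentr Z W.

Let sZ : subgroup Z. Proof. exact: acentr_subgroup. Qed.

Let sh0 : subgroup h0. Proof. by apply/subgroupI/acentr_subgroup. Qed.

(** The uniform bound over [Z] is what [annihilator_symmetry] asks for, applied to the bracket with
    its arguments exchanged. *)
Lemma acentr_acentr_finite_index : virtually_sub h h0.
Proof.
apply: virtually_subI => //; first exact: acentr_subgroup.
  exact: virtually_sub_refl.
have [n cov] := acentr_uniform; exists n.
have H := annihilator_symmetry flipDl flipDr sW sZ cov.
by apply: covered_byS H => // y /(virtually_sub_bracketC _ _ sW).
Qed.

Lemma acentr_bracket_finite :
  exists2 E : set g, [/\ subgroup E, W `<=` E & virtually_sub E W] &
    forall x y, Z x -> h0 y -> E (bracket x y).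
Proof.
have [n cov] := acentr_uniform.
have [x Zx|y [_ Zy]|E EW EP] := neumann_bilinear (d := n) flipDl flipDr sW sh0 sZ.
- by apply: covered_byS (cov x Zx) => // _ [y [hy _] <-]; exists y.
- exact/virtually_sub_bracketC.
by exists E => // x y Zx h0y; apply: EP.
Qed.

Lemma definable_finite_extension A B : subgroup A -> subgroup B ->
  B `<=` A -> virtually_sub A B -> definable_subset D B -> definable_subset D A.
Proof.
move=> sA sB BA [n /(covered_by_inside sB)[r [_ rA rP]]] dB.
have -> : A = addset [set` r] B.
  apply/seteqP; split=> [x /rP[b br Bb]|_ [b /rA Ab [c /BA Ac <-]]].
    by exists b => //; exists (x - b) => //; rewrite addrC subrK.
  exact: subgroupD.
exact/definable_addset/dB/definable_seq.
Qed.


Lemma centr_subgroup X Y : subgroup Y -> subgroup (centr X Y).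
Proof.
move=> sY; split=> [y _|x x' Cx Cx' y Xy]; first by rewrite bracket0l; exact: subgroup0.
by rewrite bracketBl; apply: subgroupB => //; [exact: Cx|exact: Cx'].
Qed.

(** Although [h] is arbitrary, [Z = C~(h/W)] is a finite extension of
    [Z `&` C(s/W)] for a finite [s] in [h0], and the latter is the intersection of
    [C(s/W)] with the sets [C(y/E)], [y] in [h0], having finite index in [C(s/W)]. *)
Lemma definable_acentr : definable_subset D Z.
Proof.
have [d /(_ h0)[s sh0' sP]] := minimal_centraliser.
have [E [sE WE EW] EP] := acentr_bracket_finite.
have dE : definable_subset D E by exact: definable_finite_extension dW.
pose C := centr [set` s] W.
have sC : subgroup C by exact: centr_subgroup.
pose P y := [set x | E (bracket x y)].
have sP' y : subgroup (P y) by exact: (annr_subgroup flipDr).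
(* If [[x, h0]] lies in [E], it is finite modulo [W], and so is [[x, h]] because [h0] has finite
   index in [h]. Conversely [E] contains [[Z, h0]]. *)
have CZ : C `&` \bigcap_(y in h0) P y = C `&` Z.
  apply/seteqP; split=> x [Cx Hx]; split=> //.
    apply: (acentrS acentr_acentr_finite_index).
    by apply: virtually_subS EW => // _ [y /Hx Ey <-].
  by move=> y; apply: EP.
(* By the choice of [s], [[C, y]] has at most [d] classes modulo [W] for each [y] in [h0], so
   [annihilator_symmetry] applies to [C] and [h0]. *)
have CvZ : virtually_sub C (C `&` Z).
  apply: virtually_subI => //; first exact: virtually_sub_refl.
  exists d; have := annihilator_symmetry bracketDl' bracketDr' sW sh0 sP.
  by apply: covered_byS => //; apply/acentrS/acentr_acentr_finite_index.
have dCZ : definable_subset D (C `&` Z).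
  move: CvZ; rewrite -CZ => /(finite_subintersection sC sP')[s' _ ->].
  apply: definable_setI; first exact/definable_centr/dW/definable_seq.
  exact/(definable_centr (definable_seq D s'))/dE.
(* [C] cuts [Z] in a subgroup of finite index, since the finitely many elements of [s] lie in [h0],
   hence in [acentr Z W]. *)
apply: definable_finite_extension dCZ => //; first exact: subgroupI.
apply: virtually_subI => //; last exact: virtually_sub_refl.
have -> : C = \bigcap_(y in [set` s]) [set x | W (bracket x y)] by [].
apply: (virtually_sub_annr_seq flipDr) => // y /sh0'[_ Zy].
apply: (virtually_sub_annr flipDr) => //.
exact/virtually_sub_bracketC.
Qed.

End Definability.
End LieRing.

(** * Normalisers *)

Section Normaliser.
Variable g : lieRingType.
Implicit Types (A B W h N X Y : set g) (x y z d : g).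

Lemma bracket_subgroup_subgroup A B : subgroup (bracket_subgroup A B).
Proof.
split=> [X [[X0 _] _] //|x y Hx Hy X HX].
by case: (HX) => -[_ XB] _; apply: XB; [exact: Hx|exact: Hy].
Qed.

Lemma mem_bracket_subgroup A B x y :
  A x -> B y -> bracket_subgroup A B (bracket x y).
Proof. by move=> Ax By; apply: sub_gen_smallest; exists x => //; exists y. Qed.

Lemma bracket_subgroup_sub A B X : subgroup X ->
  (forall x y, A x -> B y -> X (bracket x y)) -> bracket_subgroup A B `<=` X.
Proof.
by move=> sX H; apply: smallest_sub => // _ [x Ax [y By <-]]; apply: H.
Qed.

Lemma bracket_subgroupS A A' B B' :
  A `<=` A' -> B `<=` B' -> bracket_subgroup A B `<=` bracket_subgroup A' B'.
Proof.
move=> AA' BB'; apply: bracket_subgroup_sub.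
  exact: bracket_subgroup_subgroup.
by move=> x y /AA' A'x /BB' B'y; apply: mem_bracket_subgroup.
Qed.

Lemma normaliser_setI A B :
  normaliser A `&` normaliser B `<=` normaliser (A `&` B).
Proof. by move=> d [dA dB] x [/dA ? /dB ?]. Qed.

Lemma normaliser_addset A B :
  normaliser A `&` normaliser B `<=` normaliser (addset A B).
Proof.
move=> d [dA dB] _ [a /dA Aa [b /dB Bb <-]]; rewrite bracketDr.
by exists (bracket d a) => //; exists (bracket d b).
Qed.

(** Here and in [normaliser_acentr] the key is [[[d, x], y] = [d, [x, y]] - [x, [d, y]]]; there [n]
    cosets for [[x, A]] give at most [n * n] for [[[d, x], A]]. *)
Lemma normaliser_centr A B : subgroup B ->
  normaliser A `&` normaliser B `<=` normaliser (centr A B).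
Proof.
move=> sB d [dA dB] x Cx y Ay.
have := subgroupB sB (dB _ (Cx y Ay)) (Cx _ (dA y Ay)).
by rewrite bracket_derivation addrK.
Qed.

Lemma normaliser_acentr A W : subgroup W ->
  normaliser A `&` normaliser W `<=` normaliser (acentr A W).
Proof.
move=> sW d [dA dW] x [n [r rn rP]].
exists (n * n)%N, [seq bracket d b - c | b <- r, c <- r].
  by rewrite size_allpairs leq_mul.
move=> _ [y Ay <-].
have [|b br Wb] := rP (bracket x y); first by exists y.
have [|c cr Wc] := rP (bracket x (bracket d y)).
  by exists (bracket d y) => //; apply: dA.
exists (bracket d b - c); first by apply/allpairsP; exists (b, c).
have -> : bracket (bracket d x) y = bracket d (bracket x y) - bracket x (bracket d y).
  by rewrite bracket_derivation addrK.
rewrite opprD addrACA -opprD -bracketBr; apply: subgroupB => //; exact: dW.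
Qed.

Lemma normaliser_bracket_subgroup A B :
  normaliser A `&` normaliser B `<=` normaliser (bracket_subgroup A B).
Proof.
move=> d [dA dB].
have sAB := bracket_subgroup_subgroup A B.
apply: (@bracket_subgroup_sub _ _ [set x | bracket_subgroup A B (bracket d x)]).
  split=> [|x y] /=; first by rewrite bracket0r; exact: (subgroup0 sAB).
  by rewrite bracketBr; apply: subgroupB.
move=> x y Ax By; rewrite /= bracket_derivation; apply: (subgroupD sAB).
  by apply: mem_bracket_subgroup => //; apply: dA.
by apply: mem_bracket_subgroup => //; apply: dB.
Qed.

(** The normaliser of [W] is [centr W W] by conversion, which also makes it definable when [W]
    is. *)
Lemma normaliser_subgroup W : subgroup W -> subgroup (normaliser W).
Proof. exact: centr_subgroup. Qed.

Lemma normaliser_bracket W x y : subgroup W ->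
  normaliser W x -> normaliser W y -> normaliser W (bracket x y).
Proof.
move=> sW Nx Ny z Wz.
have := subgroupB sW (Nx _ (Ny z Wz)) (Ny _ (Nx z Wz)).
by rewrite bracket_derivation addrK.
Qed.

Lemma lie_subring_normaliser h : lie_subring h -> h `<=` normaliser h.
Proof. by move=> [_ hb] x hx y; apply: hb. Qed.

Lemma subgroup_lcs h n : subgroup h -> subgroup (lower_central_series h n).
Proof. by case: n => // n _; apply: bracket_subgroup_subgroup. Qed.

Lemma normaliser_lcs h n : normaliser h `<=` normaliser (lower_central_series h n).
Proof.
elim: n => // n IH d dh; apply: normaliser_bracket_subgroup.
by split; [exact: IH|].
Qed.

Lemma lcs_sub h n : lie_subring h -> lower_central_series h n `<=` h.
Proof.
move=> [sh hb]; elim: n => // n IH.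
by apply: bracket_subgroup_sub => // x y /IH hx; apply: hb.
Qed.

Lemma lcsS h n : lie_subring h ->
  lower_central_series h n.+1 `<=` lower_central_series h n.
Proof.
move=> Lh; have [sh hb] := Lh; have sn := subgroup_lcs n sh.
apply: bracket_subgroup_sub => // x y lx hy; apply: bracketC_in => //.
by apply: normaliser_lcs lx; apply: lie_subring_normaliser.
Qed.

Lemma subgroup_derived h n : subgroup h -> subgroup (derived_series h n).
Proof. by case: n => // n _; apply: bracket_subgroup_subgroup. Qed.

Lemma normaliser_derived h n : normaliser h `<=` normaliser (derived_series h n).
Proof.
by elim: n => // n IH d dh; apply: normaliser_bracket_subgroup; split; exact: IH.
Qed.

Lemma derived_sub h n : lie_subring h -> derived_series h n `<=` h.
Proof.
move=> [sh hb]; elim: n => // n IH.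
by apply: bracket_subgroup_sub => // x y /IH hx /IH hy; apply: hb.
Qed.

Lemma lie_subring_derived h n : lie_subring h -> lie_subring (derived_series h n).
Proof.
move=> Lh; split; first by apply: subgroup_derived; case: Lh.
move=> x y hx; apply: normaliser_derived.
by apply: lie_subring_normaliser => //; apply: derived_sub hx.
Qed.

Lemma derivedS h h' n : h `<=` h' -> derived_series h n `<=` derived_series h' n.
Proof. by move=> hh'; elim: n => // n IH; apply: bracket_subgroupS. Qed.

Lemma derived_sub_lcs h n : lie_subring h ->
  derived_series h n `<=` lower_central_series h n.
Proof.
move=> Lh; elim: n => // n IH.
by apply: bracket_subgroupS => //; apply: derived_sub.
Qed.

Lemma iter_bracket_subgroupS A A' B B' n : A `<=` A' -> B `<=` B' ->
  iter n (fun X => bracket_subgroup X B) A `<=`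
  iter n (fun X => bracket_subgroup X B') A'.
Proof. by move=> AA' BB'; elim: n => // n IH; apply: bracket_subgroupS. Qed.

End Normaliser.

(** * Definable nilpotent envelopes *)

Section Envelope.
Variables (L : language) (M : fo_structure L) (g : lieRingType).
Variables (D : definable_lie_ring M g) (hMc : hereditarily_Mc D).
Implicit Types (W : set g) (x y z d : g).

(** * Ladders above a definable ideal *)

Section Ladder.
Variables (h N : set g).
Hypotheses (Lh : lie_subring h) (sN : subgroup N) (dN : definable_subset D N).
Hypotheses (Nh : N `<=` h) (hN : h `<=` normaliser N).

Let sh : subgroup h := proj1 Lh.
(** The rungs and auxiliary sets are kept stable under [G], as the envelope has to be; since [h]
    lies in [G], they are stable under [h] too. *)
Let G := normaliser h `&` normaliser N.

Let hG : h `<=` G.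
Proof. by move=> x hx; split; [exact: lie_subring_normaliser|exact: hN]. Qed.

(** Chains [N = W_0 <= ... <= W_m] of definable subgroups, each normalised by
    [G] and mapped by [h] into the preceding one; the index is [W_m]. *)
Inductive ladder : set g -> Prop :=
| ladder0 : ladder N
| ladderS W W' : ladder W -> definable_subset D W' -> subgroup W' ->
    W `<=` W' -> W' `<=` normaliser N -> G `<=` normaliser W' ->
    (forall x y, W' x -> h y -> W (bracket x y)) -> ladder W'.

Lemma ladderP W : ladder W -> [/\ definable_subset D W, subgroup W,
  N `<=` W, W `<=` normaliser N & G `<=` normaliser W].
Proof.
elim=> {W} [|W W' _ [_ _ NW _ _] dW' sW' WW' W'N GW' _]; last first.
  by split=> // x /NW /WW'.
by split=> // [x /Nh /hN|x []].
Qed.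

(** * Extending a ladder by one term of the lower central series *)

Section Step.
Variables (W : set g) (c : nat).
Hypotheses (ladW : ladder W) (hc : lower_central_series h c `<=` N).

Let dW : definable_subset D W. Proof. by case: (ladderP ladW). Qed.
Let sW : subgroup W. Proof. by case: (ladderP ladW). Qed.
Let NW : N `<=` W. Proof. by case: (ladderP ladW). Qed.
Let WN : W `<=` normaliser N. Proof. by case: (ladderP ladW). Qed.
Let GW : G `<=` normaliser W. Proof. by case: (ladderP ladW). Qed.

(** The factor [normaliser N] ensures that brackets of [Z] with [lower_central_series h c], which
    lies in [N], end up in [N]. *)
Let Z := acentr h W `&` normaliser N.
Let h0 := h `&` acentr (acentr h W) W.
Let F := addset (bracket_subgroup Z h0) W.
Let Z1 := Z `&` centr h F.
Let h1 := h0 `&` centr F W.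
(** These groups descend from [[Z1, h1] + W] at [i = 0] to [W] at [i = c]; they are the rungs
    between [W] and the new top [Z2]. *)
Let F1 i := addset (bracket_subgroup Z1 (h1 `&` lower_central_series h i)) W.
Let Z2 := Z `&` centr h (F1 0).

Let Gh : G `<=` normaliser h. Proof. by move=> d []. Qed.

Let Wh x y : W x -> h y -> W (bracket x y).
Proof. by move=> Wx hy; apply: bracketC_in => //; apply: GW Wx; apply: hG. Qed.

Let sZ : subgroup Z.
Proof. by apply: subgroupI; [exact: acentr_subgroup|exact: normaliser_subgroup]. Qed.

Let GZ : G `<=` normaliser Z.
Proof.
move=> d Gd; apply: normaliser_setI; split.
  by apply: normaliser_acentr => //; split; [exact: Gh|exact: GW].
by apply: normaliser_centr => //; split; case: Gd.
Qed.

Let dZ : definable_subset D Z.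
Proof.
by apply: definable_setI; [exact: definable_acentr|exact: definable_centr].
Qed.

Let Gh0 : G `<=` normaliser h0.
Proof.
move=> d Gd; apply: normaliser_setI; split; first exact: Gh.
apply: normaliser_acentr => //; split; last exact: GW.
by apply: normaliser_acentr => //; split; [exact: Gh|exact: GW].
Qed.

Let sh0 : subgroup h0.
Proof. by apply/subgroupI/acentr_subgroup. Qed.

Let sF : subgroup F.
Proof. by apply: subgroup_addset => //; apply: bracket_subgroup_subgroup. Qed.

Let WF : W `<=` F.
Proof. by apply: sub_addsetr; apply: bracket_subgroup_subgroup. Qed.

Let GF : G `<=` normaliser F.
Proof.
move=> d Gd; apply: normaliser_addset; split; last exact: GW.
by apply: normaliser_bracket_subgroup; split; [exact: GZ|exact: Gh0].
Qed.

Let FW : virtually_sub F W.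
Proof.
have [E [sE WE EW] EP] := acentr_bracket_finite hMc sW dW sh.
apply: virtually_subS EW => //; apply: addset_sub => //.
by apply: bracket_subgroup_sub => // x y [Zx _]; apply: EP.
Qed.

(** As [h0] has finite index in [h], only finitely many conditions are added to
    those defining [Z]. *)
Let definable_centr_finite X (B h' : set g) : definable_subset D X -> subgroup X ->
  definable_subset D B -> subgroup B -> subgroup h' -> h' `<=` h ->
  virtually_sub h h' ->
  (forall x y, X x -> h' y -> B (bracket x y)) ->
  definable_subset D (X `&` centr h B).
Proof.
move=> dX sX dB sB sh' h'h [n /(covered_by_inside sh')[r [_ rh rP]]] XB.
have -> : X `&` centr h B = X `&` centr [set` r] B.
  apply/seteqP; split=> x [Xx Cx]; split=> // y; first by move=> /rh; apply: Cx.
  move=> /rP[b br h'b]; rewrite -(subrK b y) bracketDr.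
  by apply: subgroupD => //; [exact: XB|exact: Cx].
exact/definable_setI/definable_centr/dB/definable_seq.
Qed.

Let dF : definable_subset D F.
Proof. exact: definable_finite_extension dW. Qed.

Let Fgen x y : Z x -> h0 y -> F (bracket x y).
Proof.
by move=> Zx h0y; apply: sub_addsetl => //; apply: mem_bracket_subgroup.
Qed.

Let hvh0 : virtually_sub h h0.
Proof. exact: (acentr_acentr_finite_index hMc). Qed.

Let h0h : h0 `<=` h. Proof. by move=> x []. Qed.

Let dZ1 : definable_subset D Z1.
Proof. exact: (definable_centr_finite _ _ _ _ _ _ hvh0). Qed.

Let sZ1 : subgroup Z1.
Proof. by apply/subgroupI/centr_subgroup. Qed.

Let GZ1 : G `<=` normaliser Z1.
Proof.
move=> d Gd; apply: normaliser_setI; split; first exact: GZ.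
by apply: normaliser_centr => //; split; [exact: Gh|exact: GF].
Qed.

Let sh1 : subgroup h1.
Proof. by apply/subgroupI/centr_subgroup. Qed.

Let Gh1 : G `<=` normaliser h1.
Proof.
move=> d Gd; apply: normaliser_setI; split; first exact: Gh0.
by apply: normaliser_centr => //; split; [exact: GF|exact: GW].
Qed.

Let FN : F `<=` normaliser N.
Proof.
have sNN := normaliser_subgroup sN.
apply: addset_sub => //; apply: bracket_subgroup_sub => // x y [_ Nx] /h0h /hN Ny.
exact: normaliser_bracket.
Qed.

Let Fh x y : F x -> h y -> F (bracket x y).
Proof. by move=> Fx hy; apply: bracketC_in => //; apply: GF Fx; apply: hG. Qed.

Let FZ : F `<=` Z.
Proof.
move=> x Fx; split; last exact: FN.
by apply: virtually_subS FW => // _ [y hy <-]; apply: Fh.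
Qed.

(** As [F] is finite modulo [W], centralising it amounts to centralising finitely many
    representatives, and these lie in the almost centraliser of [h]. *)
Let hvh1 : virtually_sub h h1.
Proof.
apply: virtually_subI => //; first exact: centr_subgroup.
have [n /(covered_by_inside sW)[r [_ rF rP]]] := FW.
have flipDr x y y' : bracket x (y + y') = bracket x y + bracket x y'.
  exact: bracketDr.
have : virtually_sub h (\bigcap_(x in [set` r]) [set y | W (bracket x y)]).
  apply: (virtually_sub_annr_seq flipDr) => // x /rF /FZ[Zx _].
  exact: (virtually_sub_annr flipDr).
have hvh : virtually_sub h h by apply: virtually_sub_refl.
have sI : subgroup (\bigcap_(x in [set` r]) [set y | W (bracket x y)]).
  split=> [x _|x y Px Py z zr]; first by rewrite /= bracket0r; exact: subgroup0.
  by rewrite /= bracketBr; apply: subgroupB => //; [exact: Px|exact: Py].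
move=> /(virtually_subI sh sh sI hvh); apply: virtually_subS => // y [hy Iy] x Fx.
have [b br Wb] := rP x Fx; apply: bracketC_in => //.
rewrite -(subrK b x) bracketDl; apply: subgroupD => //; first exact: Wh.
exact: Iy.
Qed.

Let sF1 i : subgroup (F1 i).
Proof. by apply: subgroup_addset => //; apply: bracket_subgroup_subgroup. Qed.

Let WF1 i : W `<=` F1 i.
Proof. by apply: sub_addsetr; apply: bracket_subgroup_subgroup. Qed.

Let F1S i : F1 i.+1 `<=` F1 i.
Proof.
apply: addset_sub => //; apply: bracket_subgroup_sub => // x y Zx [h1y ly].
apply: sub_addsetl => //; apply: mem_bracket_subgroup => //; split=> //.
exact: lcsS.
Qed.

Let F1F i : F1 i `<=` F.
Proof.
apply: addset_sub => //; apply: bracket_subgroup_sub => // x y [Zx _] [[h0y _] _].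
exact: Fgen.
Qed.

Let GF1 i : G `<=` normaliser (F1 i).
Proof.
move=> d Gd; apply: normaliser_addset; split; last exact: GW.
apply: normaliser_bracket_subgroup; split; first exact: GZ1.
apply: normaliser_setI; split; first exact: Gh1.
by apply: normaliser_lcs; exact: Gh.
Qed.

Let bracket_rot x y z :
  bracket (bracket x y) z = bracket (bracket x z) y + bracket x (bracket y z).
Proof.
rewrite [LHS]bracket_antisym bracket_derivation opprD.
by rewrite (bracket_antisym z x) (bracket_antisym z y) bracketNr bracketNl !opprK.
Qed.

(** For [x] in [Z1], [y] in [h1] and [z] in [h], the first summand of
    [[[x, y], z] = [[x, z], y] + [x, [y, z]]] lies in [W], as [[x, z]] is in [F];
    in the second one [[y, z]] is one step further down the central series. *)
Let F1h i x y : F1 i x -> h y -> F1 i.+1 (bracket x y).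
Proof.
move=> F1x hy; have sP : subgroup [set x | F1 i.+1 (bracket x y)].
  split=> [|x' y' F1x' F1y'] /=; first by rewrite bracket0l; exact: subgroup0.
  by rewrite bracketBl; apply: subgroupB.
apply: (addset_sub sP) F1x; last by move=> w Ww; apply/WF1/Wh.
apply: bracket_subgroup_sub => // a b [Za Ca] [[h0b Cb] lb] /=.
rewrite bracket_rot; apply: subgroupD => //.
  by apply: WF1; apply: (bracketC_in sW); apply: Cb; apply: Ca.
apply: sub_addsetl => //; apply: mem_bracket_subgroup => //; split; last first.
  exact: mem_bracket_subgroup.
by apply: bracketC_in => //; apply: Gh1 => //; apply: hG.
Qed.

Let ladder_F1 i : (i <= c)%N -> ladder (F1 i).
Proof.
move=> ic; rewrite -(subKn ic); elim: (c - i)%N => [|m IH].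
  (* The induction runs downwards from [F1 c = W]: brackets of [Z1] with [lower_central_series h c]
     lie in [N]. *)
  rewrite subn0; suff -> : F1 c = W by [].
  apply/seteqP; split=> //; apply: addset_sub => //.
  apply: bracket_subgroup_sub => // x y [[_ Nx] _] [_ /hc Ny].
  by apply/NW/Nx.
(* For [m >= c] both truncated differences are 0 and the rung does not change. *)
have [mc|cm] := ltnP m c; last first.
  have -> // : (c - m.+1 = c - m)%N by lia.
have -> : (c - m.+1)%N = (c - m).-1 by lia.
have E : (c - m)%N = (c - m).-1.+1 by lia.
move: IH; rewrite {1}E => IH.
apply: (ladderS IH) => //.
- apply: definable_finite_extension dW => //.
  by apply: virtually_subS FW => //; apply: F1F.
- by move=> x /F1F /FN.
exact: F1h.
Qed.

Lemma ladder_step j : lower_central_series h j.+1 `<=` W ->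
  exists2 W', ladder W' & lower_central_series h j `<=` W'.
Proof.
move=> hj; exists Z2; last first.
  move=> x lx; have hx := lcs_sub Lh lx.
  have Wx y : h y -> W (bracket x y).
    by move=> hy; apply: hj; apply: mem_bracket_subgroup.
  split; last by move=> y hy; apply/WF1/Wx.
  split; last exact: hN.
  by apply: virtually_sub_refl => _ [y hy <-]; apply: Wx.
have dF1 : definable_subset D (F1 0) by case: (ladderP (ladder_F1 (leq0n c))).
(* As [F1 0] lies in [F], [Z2] can be cut out from [Z1] instead of [Z]. Since [[Z1, h1]] lies in
   [F1 0], finitely many conditions then define it. *)
have Z2E : Z2 = Z1 `&` centr h (F1 0).
  apply/seteqP; split=> x; last by move=> [[Zx _] Cx].
  by move=> [Zx Cx]; split=> //; split=> // y /Cx /F1F.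
apply: (ladderS (ladder_F1 (leq0n c))).
- rewrite Z2E; apply: (definable_centr_finite _ _ _ _ sh1) => // [x [[]]//|x y Z1x h1y].
  apply: sub_addsetl => //; apply: mem_bracket_subgroup => //; split=> //.
  by case: h1y => -[].
- by apply/subgroupI/centr_subgroup.
- move=> x F1x; split; first exact/FZ/F1F/F1x.
  by move=> y hy; apply/F1S/F1h.
- by move=> x [[]].
- move=> d Gd; apply: normaliser_setI; split; first exact: GZ.
  by apply: normaliser_centr => //; split; [exact: Gh|exact: GF1].
by move=> x y [_ Cx] /Cx.
Qed.

End Step.

Lemma ladder_top c : lower_central_series h c `<=` N ->
  exists2 W, ladder W & h `<=` W.
Proof.
move=> hc; suff H i : (i <= c)%N ->
    exists2 W, ladder W & lower_central_series h (c - i) `<=` W.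
  by have [W ladW] := H c (leqnn c); rewrite subnn; exists W.
elim: i => [_|i IH ic]; first by rewrite subn0; exists N => //; exact: ladder0.
have [W ladW] := IH (ltnW ic).
have -> : (c - i = (c - i.+1).+1)%N by lia.
by move=> /(ladder_step ladW hc).
Qed.

(** [K] consists of the elements of [normaliser N] mapping every rung of the
    ladder up to [W] into the rung below it. *)
Lemma ladder_stabiliser W : ladder W -> exists K n,
  [/\ [/\ definable_subset D K, lie_subring K, h `<=` K & G `<=` normaliser K],
      forall x y, W x -> K y -> W (bracket x y) &
      iter n (fun X => bracket_subgroup X K) W `<=` N].
Proof.
elim=> {W} [|W W' ladW [K [n [[dK LK hK GK] KW Kn]]] dW' sW' WW' W'N GW' hW'].
  exists (normaliser N), 0%N; split=> //; last first.
    by move=> x y Nx Ny; apply: bracketC_in => //; apply: Ny.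
  split=> //; first exact: definable_centr.
    by split; [exact: normaliser_subgroup|move=> x y; exact: normaliser_bracket].
  by move=> d [_ dN']; apply: normaliser_centr.
have [dW sW _ _ GW] := ladderP ladW.
exists (K `&` centr W' W), n.+1; split.
- split.
  + exact/definable_setI/definable_centr.
  + split; first by apply: subgroupI; [case: LK|exact: centr_subgroup].
    move=> x y [Kx Cx] [Ky Cy]; split; first by case: LK => _; apply.
    move=> w W'w.
    have := subgroupB sW (Cx _ (WW' _ (Cy w W'w))) (Cy _ (WW' _ (Cx w W'w))).
    by rewrite (bracket_derivation x) addrK.
  + move=> x hx; split; first exact: hK.
    by move=> y W'y; apply: bracketC_in => //; apply: hW'.
  + move=> d Gd; apply: normaliser_setI; split; first exact: GK.
    by apply: normaliser_centr => //; split; [exact: GW'|exact: GW].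
- move=> x y W'x [_ Cy]; by apply: WW'; apply: (bracketC_in sW); apply: Cy.
rewrite iterSr; apply: subset_trans Kn; apply: iter_bracket_subgroupS.
  apply: bracket_subgroup_sub => // x y W'x [_ Cy].
  by apply: bracketC_in => //; apply: Cy.
by move=> x [].
Qed.

Lemma nilpotent_mod_envelope c : lower_central_series h c `<=` N ->
  exists K n, [/\ definable_subset D K, lie_subring K, h `<=` K,
    normaliser h `&` normaliser N `<=` normaliser K &
    lower_central_series K n `<=` N].
Proof.
move=> /ladder_top[W ladW hW].
have [dW sW _ _ GW] := ladderP ladW.
have [K [n [[dK LK hK GK] KW Kn]]] := ladder_stabiliser ladW.
(* Intersecting with the top rung makes the lower central series start inside [W], from where [n]
   brackets with [K] lead into [N]. *)
exists (K `&` W), n; split.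
- exact: definable_setI.
- split; first by apply: subgroupI => //; case: LK.
  by move=> x y [Kx Wx] [Ky Wy]; split; [case: LK => _; apply|exact: KW].
- by move=> x hx; split; [exact: hK|exact: hW].
- by move=> d Gd; apply: normaliser_setI; split; [exact: GK|exact: GW].
by apply: subset_trans Kn; apply: iter_bracket_subgroupS => x [].
Qed.

End Ladder.

(** * Envelopes of nilpotent and of soluble subrings *)

Lemma nilpotent_envelope (h : set g) : lie_subring h -> nilpotent h ->
  exists h1 : set g, [/\ definable_subset D h1, lie_subring h1, nilpotent h1,
    h `<=` h1 & normaliser h `<=` normaliser h1].
Proof.
move=> Lh [c hc]; have sh := proj1 Lh.
have s0 : subgroup [set (0 : g)] by split=> // x y -> ->; rewrite subrr.
have N0 d : normaliser [set (0 : g)] d by move=> y ->; rewrite /= bracket0r.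
have Nh : [set 0] `<=` h by move=> x ->; exact: subgroup0.
have hN : h `<=` normaliser [set 0] by move=> x _; exact: N0.
have hc0 : lower_central_series h c `<=` [set 0] by rewrite hc.
have [K [n [dK LK hK GK Kn]]] :=
  nilpotent_mod_envelope Lh s0 (definable_set1 D 0) Nh hN hc0.
exists K; split=> //; last by move=> d dh; apply: GK.
exists n; apply/seteqP; split=> // x ->.
exact: (subgroup0 (subgroup_lcs _ (proj1 LK))).
Qed.

(** Induction on [n] with [N] varying: the derived term of index [n] is absorbed together with [N]
    into an envelope [K], which takes the place of [N]. Whatever normalises [h] and [N] normalises
    [K], in particular [h] does, so the hypotheses persist. *)
Lemma soluble_mod_envelope (h : set g) n : lie_subring h -> forall N : set g,
  definable_subset D N -> lie_subring N -> soluble N -> h `<=` normaliser N ->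
  derived_series h n `<=` N ->
  exists h1 : set g, [/\ definable_subset D h1, lie_subring h1, soluble h1,
    h `<=` h1 & normaliser h `&` normaliser N `<=` normaliser h1].
Proof.
move=> Lh; elim: n => [|n IH] N dN LN solN hN hn.
  by exists N; split=> // d [].
have [sN bN] := LN.
pose a := derived_series h n.
have La : lie_subring a by apply: lie_subring_derived.
have ah : a `<=` h by apply: derived_sub.
have aN : a `<=` normaliser N by move=> x /ah /hN.
(* [a + N] is abelian modulo [N], because [[a, a]] is the next derived term and lies in [N]. *)
have bb x y : addset a N x -> addset a N y -> N (bracket x y).
  move=> [u au [v Nv <-]] [u' au' [v' Nv' <-]].
  rewrite bracketDl !bracketDr; apply: subgroupD => //.
    apply: subgroupD => //; last exact: aN.
    by apply: hn; apply: mem_bracket_subgroup.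
  apply: subgroupD => //; last exact: bN.
  by apply: bracketC_in => //; apply: aN.
have sa : subgroup a by case: La.
have Nb : N `<=` addset a N by exact: sub_addsetr.
have Lb : lie_subring (addset a N).
  by split; [exact: subgroup_addset|move=> x y bx by'; apply/Nb/bb].
have bN' : addset a N `<=` normaliser N.
  by move=> x bx y /Nb; apply: bb.
have b1 : lower_central_series (addset a N) 1 `<=` N.
  by apply: bracket_subgroup_sub => // x y; apply: bb.
have [K [m [dK LK bK GK Km]]] := nilpotent_mod_envelope Lb sN dN Nb bN' b1.
have solK : soluble K.
  (* [m] derived steps take [K] into [N], and [p] more reach 0. *)
  have [p Np] := solN; exists (p + m)%N; apply/seteqP; split=> x; last first.
    by move=> ->; exact: (subgroup0 (subgroup_derived _ (proj1 LK))).
  rewrite /derived_series iterD -[X in X x]/(derived_series (derived_series K m) p) -Np.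
  by apply: derivedS => y /(derived_sub_lcs LK) /Km.
have NK d : normaliser h d -> normaliser N d -> normaliser K d.
  move=> dh dN'; apply: GK; split=> //; apply: normaliser_addset; split=> //.
  exact: normaliser_derived.
have [|x ax|h1 [dh1 Lh1 sol1 hh1 Gh1]] := IH K dK LK solK.
- by move=> x hx; apply: NK; [exact: lie_subring_normaliser|exact: hN].
- exact/bK/sub_addsetl.
by exists h1; split=> // d [dh dN']; apply: Gh1; split=> //; apply: NK.
Qed.

End Envelope.

Theorem theorem0p7 (L : language) (M : fo_structure L) (g : lieRingType)
    (D : definable_lie_ring M g) (hMc : hereditarily_Mc D)
    (h : set g) (hsub : lie_subring h) :
  (soluble h ->
     exists h1 : set g,
       [/\ definable_subset D h1, lie_subring h1, soluble h1,
           h `<=` h1 & normaliser h `<=` normaliser h1]) /\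
  (nilpotent h ->
     exists h1 : set g,
       [/\ definable_subset D h1, lie_subring h1, nilpotent h1,
           h `<=` h1 & normaliser h `<=` normaliser h1]).
Proof.
split; last exact: nilpotent_envelope.
move=> [n hn].
have N0 d : normaliser [set (0 : g)] d by move=> y ->; rewrite /= bracket0r.
have L0 : lie_subring [set (0 : g)].
  by split; [split=> // x y -> ->; rewrite subrr|move=> x y -> _; rewrite /= bracket0l].
have [|||h1 [dh1 Lh1 sol1 hh1 Gh1]] :=
    soluble_mod_envelope hMc (n := n) hsub (definable_set1 D 0) L0.
- by exists 0%N.
- by move=> x _.
- by rewrite hn.
by exists h1; split=> // d dh; apply: Gh1.
Qed.
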